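(* Let $Y$ and $\hat Y$ be continuous Lagrangian paths on $[a,b]$. Then $$\operatorname{Mas}(Y,\hat Y,[a,b])=\operatorname{Mas}(E,\hat Y,[a,b])-\operatorname{Mas}(E,Y,[a,b])+\mu(\hat Y(a),Y(a))-\mu(\hat Y(b),Y(b)).$$ If in addition $Y(a)=\hat Y(a)$ and $Y(b)=\hat Y(b)$ hold, then $$\operatorname{Mas}(Y,\hat Y,[a,b])=\operatorname{Mas}(E,\hat Y,[a,b])-\operatorname{Mas}(E,Y,[a,b]).$$ Here $E=\begin{pmatrix}0\\ I\end{pmatrix}$ is regarded as a constant Lagrangian path.
   Context: Notation. $n\in\mathbb N$, $[a,b]\subseteq\mathbb R$, $\mathcal J=\begin{pmatrix}0&I\\ -I&0\end{pmatrix}\in\mathbb R^{2n\times2n}$, $E=\begin{pmatrix}0\\ I\end{pmatrix}\in\mathbb R^{2n\times n}$. A Lagrangian plane is a constant $Y\in\mathbb R^{2n\times n}$ with $Y^T\mathcal JY=0$ and $\operatorname{rank}Y=n$. A continuous Lagrangian path on $[a,b]$ is a continuous $Y:[a,b]\to\mathbb R^{2n\times n}$ such that every $Y(t)$ is a Lagrangian plane. We write $Y=\begin{pmatrix}X\\ U\end{pmatrix}$ with $n\times n$ blocks (similarly $\hat Y$ with $\hat X,\hat U$). The Wronskian is $W(Y,\hat Y)=Y^T\mathcal J\hat Y$. Comparative index. For Lagrangian planes $Y,\hat Y$ put $\mathcal M=(I-X^\dagger X)W(Y,\hat Y)$, $V=I-\mathcal M^\dagger\mathcal M$, $\mathcal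 P=V[W(Y,\hat Y)]^TX^\dagger\hat XV$ (a symmetric matrix), where $\dagger$ is the Moore–Penrose pseudoinverse. The comparative index is $\mu(Y,\hat Y)=\operatorname{rank}\mathcal M+\operatorname{ind}\mathcal P$, with $\operatorname{ind}$ the number of negative eigenvalues. Maslov index. For continuous Lagrangian paths $Y,\hat Y$ put $$\Gamma(t)=-[X(t)+iU(t)][X(t)-iU(t)]^{-1}[\hat X(t)-i\hat U(t)][\hat X(t)+i\hat U(t)]^{-1},$$ a continuous unitary matrix on $[a,b]$. There exist a partition $a=t_0<t_1<\dots<t_p=b$ and numbers $\varepsilon_k\in(0,\pi)$, $k=1,\dots,p$, such that $\Gamma(t)-\exp\{i(\pi\pm\varepsilon_k)\}I$ is invertible for all $t\in[t_{k-1},t_k]$. For $t\in[t_{k-1},t_k]$ let $\ell(t,\varepsilon_k)=\sum_{\theta\in[0,\varepsilon_k)}\dim\ker\big(\Gamma(t)-\exp\{i(\pi+\theta)\}I\big)$, i.e. the number of eigenvalues (with multiplicity) of $\Gamma(t)$ on the arc $\{e^{i\theta}:\theta\in[\pi,\pi+\varepsilon_k)\}$. The Maslov index is $$\operatorname{Mas}(Y,\hat Y,[a,b]):=\sum_{k=1}^p\big(\ell(t_k,\varepsilon_k)-\ell(t_{k-1},\varepsilon_k)\big),$$ which is independent of the choice of the partition and the $\varepsilon_k$. *)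

(* Defs.v *)
From HB Require Import structures.
From mathcomp Require Import all_boot all_order all_algebra.
From mathcomp Require Import all_classical all_reals all_analysis.
From mathcomp Require Import complex.
Set Implicit Arguments.
Unset Strict Implicit.
Unset Printing Implicit Defensive.
Import Order.TTheory GRing.Theory Num.Theory.
Import numFieldNormedType.Exports.
Local Open Scope classical_set_scope.
Local Open Scope ring_scope.

Definition penrose (R : realType) m n (A : 'M[R]_(m, n)) (B : 'M[R]_(n, m)) :=
  [/\ A *m B *m A = A, B *m A *m B = B,
      (A *m B)^T = A *m B & (B *m A)^T = B *m A].

(* The default value 0 is never used: see [mp_pinvP] and [penrose_uniq]. *)
Definition mp_pinv (R : realType) m n (A : 'M[R]_(m, n)) : 'M[R]_(n, m) :=
  xget 0 [set B | penrose A B].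

Lemma penrose_uniq (R : realType) m n (A : 'M[R]_(m, n)) (B C : 'M[R]_(n, m)) :
  penrose A B -> penrose A C -> B = C.
Proof.
move=> [ABA BAB ABt BAt] [ACA CAC ACt CAt].
have AB_AC : A *m B = A *m C.
  have e : A *m B = (A *m C) *m (A *m B) by rewrite mulmxA ACA.
  by rewrite -ABt e trmx_mul ABt ACt mulmxA ABA.
have BA_CA : B *m A = C *m A.
  have e : B *m A = (B *m A) *m (C *m A) by rewrite -!mulmxA (mulmxA A) ACA.
  by rewrite -BAt e trmx_mul BAt CAt -!mulmxA (mulmxA A) ABA.
by rewrite -BAB -mulmxA AB_AC mulmxA BA_CA CAC.
Qed.

Lemma gram_unit (R : realType) m n (A : 'M[R]_(m, n)) :
  row_free A -> A *m A^T \in unitmx.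
Proof.
move=> Afree; rewrite -row_free_unit; apply/row_freeP.
have inj u : u *m (A *m A^T) = 0 -> u = 0 :> 'rV_m.
  move=> uG0; apply: (row_free_inj Afree); rewrite /= mul0mx.
  have /matrixP/(_ 0 0) : (u *m A) *m (u *m A)^T = 0.
    by rewrite trmx_mul mulmxA -[u *m A *m _]mulmxA uG0 mul0mx.
  rewrite !mxE => /eqP; rewrite psumr_eq0 => [/allP sq0|j _]; last first.
    by rewrite [X in _ * X]mxE -expr2 sqr_ge0.
  apply/matrixP => i j; rewrite ord1 [RHS]mxE; apply/eqP.
  have := sq0 j (mem_index_enum j).
  by rewrite /= [X in _ * X]mxE mulf_eq0 orbb.
by apply/row_freeP/inj_row_free.
Qed.

Lemma mp_pinvP (R : realType) m n (A : 'M[R]_(m, n)) : penrose A (mp_pinv A).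
Proof.
apply: xgetPex.
have [r [C [B [defA Cfree Bfree]]]] : exists r (C : 'M[R]_(m, r)) B,
    [/\ A = C *m B, row_free C^T & row_free B].
  exists (\rank A), (col_base A), (row_base A); split.
  - by rewrite mulmx_base.
  - by rewrite /row_free mxrank_tr; exact: col_base_full.
  - exact: row_base_free.
have Bu := gram_unit Bfree.
have Cu := gram_unit Cfree; rewrite trmxK in Cu.
pose B' := B^T *m invmx (B *m B^T); pose C' := invmx (C^T *m C) *m C^T.
have BB' : B *m B' = 1%:M by rewrite mulmxA mulmxV.
have C'C : C' *m C = 1%:M by rewrite -mulmxA mulVmx.
have AX : A *m (B' *m C') = C *m C'.
  by rewrite defA -mulmxA (mulmxA B) BB' mul1mx.
have XA : B' *m C' *m A = B' *m B.
  by rewrite defA -mulmxA (mulmxA C') C'C mul1mx.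
exists (B' *m C'); split.
- by rewrite AX defA -mulmxA (mulmxA C') C'C mul1mx.
- by rewrite XA -mulmxA (mulmxA B) BB' mul1mx.
- rewrite AX /C' !trmx_mul trmxK trmx_inv trmx_mul trmxK.
  by rewrite mulmxA.
- rewrite XA /B' !trmx_mul trmxK trmx_inv trmx_mul trmxK.
  by rewrite mulmxA.
Qed.

Section Lagrangian.
Variables (R : realType) (n : nat).
Implicit Types Y Yh : 'M[R]_(n + n, n).

Definition symplectic_mx : 'M[R]_(n + n) := block_mx 0 1%:M (- 1%:M) 0.

(* The vertical plane E. *)
Definition vert_plane : 'M[R]_(n + n, n) := col_mx 0 1%:M.

Definition wronskian Y Yh : 'M[R]_n := Y^T *m symplectic_mx *m Yh.

Definition lagrangian_plane Y := wronskian Y Y = 0 /\ \rank Y = n.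

(* A path is a total function of which only the values on [a, b] matter. *)
Definition lagrangian_path (a b : R) (Y : R -> 'M[R]_(n + n, n)) :=
  {within `[a, b], continuous Y} /\
  (forall t, t \in `[a, b] -> lagrangian_plane (Y t)).

(* Number of negative eigenvalues, with multiplicity. *)
Definition neg_index (P : 'M[R]_n) : nat :=
  \sum_(x \in [set x : R | x < 0]) mup x (char_poly P).

Definition comp_index_M Y Yh : 'M[R]_n :=
  (1%:M - mp_pinv (usubmx Y) *m usubmx Y) *m wronskian Y Yh.

Definition comp_index_P Y Yh : 'M[R]_n :=
  let M := comp_index_M Y Yh in
  let V := 1%:M - mp_pinv M *m M in
  V *m (wronskian Y Yh)^T *m mp_pinv (usubmx Y) *m usubmx Yh *m V.

Definition comp_index Y Yh : nat :=
  (\rank (comp_index_M Y Yh) + neg_index (comp_index_P Y Yh))%N.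

(* X + iU and X - iU *)
Definition cplus Y : 'M[R[i]]_n :=
  map_mx (real_complex R) (usubmx Y) +
  'i%C *: map_mx (real_complex R) (dsubmx Y).
Definition cminus Y : 'M[R[i]]_n :=
  map_mx (real_complex R) (usubmx Y) -
  'i%C *: map_mx (real_complex R) (dsubmx Y).

Definition Gamma Y Yh : 'M[R[i]]_n :=
  - (cplus Y *m invmx (cminus Y) *m cminus Yh *m invmx (cplus Yh)).

Definition expi (x : R) : R[i] := (cos x +i* sin x)%C.

(* \rank (cokermx A) is the dimension of {v | A *m v = 0}; the sum over the
   infinite set of angles is well defined as only finitely many angles in
   [0, 2 pi) contribute. *)
Definition arc_count (G : 'M[R[i]]_n) (eps : R) : nat :=
  \sum_(x \in [set x : R | 0 <= x < eps])
     \rank (cokermx (G - (expi (pi + x))%:M)).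

(* Only t 0, ..., t p and eps 1, ..., eps p matter. *)
Definition maslov_partition (a b : R) (G : R -> 'M[R[i]]_n)
    (p : nat) (t eps : nat -> R) :=
  [/\ t 0%N = a, t p = b &
      forall k, (k < p)%N ->
        [/\ t k < t k.+1, 0 < eps k.+1 < pi &
            forall s, s \in `[t k, t k.+1] ->
              G s - (expi (pi + eps k.+1))%:M \in unitmx /\
              G s - (expi (pi - eps k.+1))%:M \in unitmx]].

Definition maslov_sum (G : R -> 'M[R[i]]_n) (p : nat) (t eps : nat -> R) : int :=
  \sum_(k < p) ((arc_count (G (t k.+1)) (eps k.+1))%:Z -
                (arc_count (G (t k)) (eps k.+1))%:Z).

(* For Lagrangian paths a partition exists and the sum does not depend on it;
   the default value 0 is only relevant for other functions. *)
Definition maslov (Y Yh : R -> 'M[R]_(n + n, n)) (a b : R) : int :=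
  let G := fun s => Gamma (Y s) (Yh s) in
  xget 0 [set m | exists p t eps,
            maslov_partition a b G p t eps /\ m = maslov_sum G p t eps].

End Lagrangian.

Arguments vert_plane {R n}.

(* Main.v *)
(* Let N(Y), for a chart in which all planes involved are graphs of symmetric
   matrices, be the matrix of the plane Y (with N(E) = 0), and let ind be the
   number of negative eigenvalues. Two facts carry the proof.

   (1) If exp(i(pi + eps)) is not an eigenvalue of Gamma(Y, Yh), the number of
   eigenvalues on the arc [pi, pi + eps) plus ind(N(Y) - N(Yh)) is the negative
   inertia of a bordered Hermitian matrix that is invertible and continuous in
   (Y, Yh); hence it is locally constant along the paths, even where the planes
   intersect.

   (2) Inertia additivity with a singular corner, applied to the matrix
   [[-N(Yh), N(Y)], [N(Y), -N(Y)]], gives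
   mu(Yh, Y) + ind(-N(Yh)) = ind(N(Y) - N(Yh)) + ind(-N(Y)).

   Applying (1) to the pairs (Y, Yh), (E, Yh) and (E, Y) and inserting (2), the
   integer Mas(Y, Yh, [a, s]) - Mas(E, Yh, [a, s]) + Mas(E, Y, [a, s])
   + mu(Yh(s), Y(s)) is a locally constant function of s on [a, b]. The charts
   disappear from the final identity, so they may be chosen locally. *)
Require Import Defs.
From mathcomp Require Import all_boot all_order all_algebra.
From mathcomp Require Import all_classical all_reals all_analysis.
From mathcomp Require Import complex zify ring lra.
Set Implicit Arguments.
Unset Strict Implicit.
Unset Printing Implicit Defensive.
Import Order.TTheory GRing.Theory Num.Theory.
Import numFieldNormedType.Exports.
Local Open Scope classical_set_scope.
Local Open Scope ring_scope.
Local Open Scope sesquilinear_scope.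

(** * Inertia of Hermitian matrices *)

(** The count on an arc jumps where the planes meet, so a matrix is wanted that stays invertible
    there and in whose inertia the jumps of the count and of [ind(N(Y) - N(Yh))] cancel. In a chart
    [- Gamma] is a quotient [G] of two Cayley transforms; let [D] be the difference of the two
    graphs, a positive multiple of [N(Y) - N(Yh)]. For [q = exp(i eps / 2)] the Hermitian matrix
    [q^* (G - 1) + q (G^* - 1)] is negative exactly along the eigenvectors of [G] off the arc, and
    it is congruent to a positive multiple of [D + D A D], where [A] depends only on [eps] and the
    first plane. That matrix degenerates with [D]. The bordered matrix [[[D, 1], [1, - A]]] does
    not: up to sign its determinant is that of [1 + D A], which is nonzero as long as
    [q^2 = exp(i eps)] is not an eigenvalue of [G]. One chart has to contain [Y], [Yh] and [E]. A
    real [tau] off the zeros of two nonzero polynomials [det(tau X - U)] is enough, because [E] lies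
    in every such chart. As [N(E) = 0] there, the terms [ind(- N)] of (2) are the corrections that
    (1) attaches to the pairs with [E]. *)

Lemma ctrmxM (C : numClosedFieldType) m n p (A : 'M[C]_(m, n)) (B : 'M[C]_(n, p)) :
  (A *m B)^t* = B^t* *m A^t*.
Proof. by rewrite trmx_mul map_mxM. Qed.

Lemma ctrmxD (C : numClosedFieldType) m n (A B : 'M[C]_(m, n)) :
  (A + B)^t* = A^t* + B^t*.
Proof. by rewrite linearD /= map_mxD. Qed.

Lemma ctrmxN (C : numClosedFieldType) m n (A : 'M[C]_(m, n)) :
  (- A)^t* = - A^t*.
Proof. by rewrite linearN /= map_mxN. Qed.

Lemma ctrmxZ (C : numClosedFieldType) m n a (A : 'M[C]_(m, n)) :
  (a *: A)^t* = a^* *: A^t*.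
Proof. by rewrite linearZ /= map_mxZ. Qed.

Lemma ctrmx0 (C : numClosedFieldType) m n : (0 : 'M[C]_(m, n))^t* = 0.
Proof. by rewrite trmx0 map_mx0. Qed.

Lemma ctrmx1 (C : numClosedFieldType) n : (1%:M : 'M[C]_n)^t* = 1%:M.
Proof. by rewrite trmx1 map_mx1. Qed.

Lemma ctrmx_unit (C : numClosedFieldType) n (A : 'M[C]_n) :
  (A^t* \in unitmx) = (A \in unitmx).
Proof. by rewrite map_unitmx unitmx_tr. Qed.

Lemma ctrmx_block (C : numClosedFieldType) m1 m2 n1 n2 (A : 'M[C]_(m1, n1))
    (B : 'M[C]_(m1, n2)) (A' : 'M[C]_(m2, n1)) (B' : 'M[C]_(m2, n2)) :
  (block_mx A B A' B')^t* = block_mx (A^t* ) (A'^t* ) (B^t* ) (B'^t* ).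
Proof. by rewrite tr_block_mx map_block_mx. Qed.

Definition herm_form (C : numClosedFieldType) n (H : 'M[C]_n) (v : 'rV_n) : C :=
  (v *m H *m v^t*) 0 0.

Definition neg_inertia (C : numClosedFieldType) n (H : 'M[C]_n) : nat :=
  \sum_j (spectral_diag H 0 j < 0)%R.

Definition neg_on (C : numClosedFieldType) m n (H : 'M[C]_n) (N : 'M[C]_(m, n)) :=
  forall v : 'rV_n, (v <= N)%MS -> v != 0 -> herm_form H v < 0.

(** An index set and its complement give diagonal projections with sum 1. The evident upper bounds
    on their ranks add up to [n], so both are attained. *)
Lemma rank_diag_mx (F : fieldType) n (d : 'rV[F]_n) :
  \rank (diag_mx d) = (\sum_j (d 0 j != 0)%R)%N.
Proof.
pose E (p : pred 'I_n) : 'M[F]_n := diag_mx (\row_j (p j)%:R).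
have rk_le p : (\rank (E p) <= \sum_j p j)%N.
  have -> : E p = \sum_j (p j)%:R *: delta_mx j j.
    apply/matrixP => i j; rewrite !mxE summxE (bigD1 j) //= big1 => [|k kj].
      by rewrite !mxE eqxx andbT addr0 mulr_natr; case: eqVneq => [->|].
    by rewrite !mxE (eq_sym j) (negbTE kj) andbF mulr0.
  apply: (big_ind2 (fun (M : 'M[F]_n) k => (\rank M <= k)%N)) => [|M1 k1 M2 k2 h1 h2|j _].
  - by rewrite mxrank0.
  - by rewrite (leq_trans (mxrank_add _ _)) // leq_add.
  case: (p j); last by rewrite scale0r mxrank0.
  by rewrite scale1r mxrank_delta.
pose p j := d 0 j != 0.
have -> : \rank (diag_mx d) = \rank (E p).
  apply/eqP; rewrite eqn_leq; apply/andP; split.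
    have -> : diag_mx d = diag_mx d *m E p; last exact: mxrankM_maxr.
    apply/matrixP => i j; rewrite mul_mx_diag !mxE /p.
    case: (eqVneq i j) => [->|_]; last by rewrite !mulr0n mul0r.
    by case: eqVneq => [->|_]; rewrite ?mulr0 ?mulr1 ?mulr1n.
  have -> : E p = diag_mx (\row_j (d 0 j)^-1) *m diag_mx d; last exact: mxrankM_maxr.
  apply/matrixP => i j; rewrite mul_diag_mx !mxE /p; case: (eqVneq i j) => /= [->|_].
    by rewrite !mulr1n; case: eqVneq => [->|dj]; rewrite ?mulr0 ?mulVf.
  by rewrite !mulr0n mulr0.
apply/eqP; rewrite eqn_leq rk_le /=.
have sumE : E p + E (fun j => ~~ p j) = 1%:M.
  apply/matrixP => i j; rewrite !mxE -mulrnDl -natrD.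
  by case: eqVneq => [->|]; case: (p _).
have : (n <= \rank (E p) + \rank (E (fun j => ~~ p j)))%N.
  by rewrite -[X in (X <= _)%N](mxrank1 F n) -sumE mxrank_add.
have : (\sum_j p j + \sum_j ~~ p j = n)%N.
  rewrite -big_split /= (eq_bigr (fun=> 1%N)) => [|j _]; last by case: (p j).
  by rewrite sum1_card card_ord.
have := rk_le (fun j => ~~ p j).
move: (\rank _) (\rank _) (\sum_j _)%N (\sum_j _)%N => r1 r2 s1 s2 h1 <- h2.
by rewrite -(leq_add2r s2) (leq_trans h2)// leq_add2l.
Qed.

Lemma herm_formM (C : numClosedFieldType) m n (N : 'M[C]_(m, n)) (H : 'M[C]_n) u :
  herm_form H (u *m N) = herm_form (N *m H *m N^t*) u.
Proof. by rewrite /herm_form ctrmxM !mulmxA. Qed.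

Lemma herm_form_ctr (C : numClosedFieldType) m n (P : 'M[C]_(m, n)) (H : 'M[C]_m) v :
  herm_form (P^t* *m H *m P) v = herm_form H (v *m P^t* ).
Proof. by rewrite herm_formM trmxCK. Qed.

Lemma herm_form_diag (C : numClosedFieldType) n (d : 'rV[C]_n) v :
  herm_form (diag_mx d) v = \sum_j d 0 j * `|v 0 j| ^+ 2.
Proof.
rewrite /herm_form mxE; apply: eq_bigr => j _.
by rewrite mul_mx_diag !mxE normCK mulrAC mulrC.
Qed.

(** Where the coordinates in the negative directions vanish, the form is nonnegative. A negative
    subspace therefore meets the kernel of [P^* E] trivially, and its dimension is at most the rank
    of [E]. *)
Lemma neg_on_rank_le (C : numClosedFieldType) m k n (P : 'M[C]_(k, n)) (d : 'rV_k)
    (N : 'M[C]_(m, n)) :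
  (forall j, d 0 j \is Num.real) -> neg_on (P^t* *m diag_mx d *m P) N ->
  (\rank N <= \sum_j (d 0 j < 0)%R)%N.
Proof.
move=> dR negN; pose E : 'M[C]_k := diag_mx (\row_j (d 0 j < 0)%R%:R).
have <- : \rank E = (\sum_j (d 0 j < 0)%R)%N.
  rewrite rank_diag_mx; apply: eq_bigr => j _; rewrite mxE.
  by case: (_ < 0); rewrite ?oner_eq0 ?eqxx.
rewrite -(mxrank_mul_ker N (P^t* *m E)).
have -> : (N :&: kermx (P^t* *m E))%MS = 0.
  apply/eqP; rewrite -submx0; apply/row_subP => i; set v := row i _.
  have [->|v0] := eqVneq v 0; first exact: sub0mx.
  have vN : (v <= N)%MS by rewrite (submx_trans (row_sub _ _))// capmxSl.
  have /sub_kermxP vK : (v <= kermx (P^t* *m E))%MS.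
    by rewrite (submx_trans (row_sub _ _))// capmxSr.
  have := negN _ vN v0; rewrite herm_form_ctr herm_form_diag.
  move=> sum_lt0; suff /le_lt_trans/(_ sum_lt0) : 0 <= \sum_j d 0 j * `|(v *m P^t* ) 0 j| ^+ 2.
    by rewrite ltxx.
  apply: sumr_ge0 => j _; have := real_leP (real0 C) (dR j); case => [dj|dj].
    by rewrite mulr_ge0 // exprn_ge0.
  move/matrixP: vK => /(_ 0 j); rewrite mulmxA; move: (v *m _) => w.
  by rewrite mul_mx_diag !mxE dj mulr1 => ->; rewrite normr0 expr0n mulr0.
by rewrite mxrank0 addn0 mulmxA mxrankM_maxr.
Qed.

Lemma neg_on_exists (C : numClosedFieldType) n (P : 'M[C]_n) (d : 'rV_n) :
  P \in unitmx -> (forall j, d 0 j \is Num.real) ->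
  exists N : 'M[C]_n, neg_on (P^t* *m diag_mx d *m P) N /\
    \rank N = (\sum_j (d 0 j < 0)%R)%N.
Proof.
move=> Pu dR; pose E : 'M[C]_n := diag_mx (\row_j (d 0 j < 0)%R%:R).
have Pu' : P^t* \in unitmx by rewrite ctrmx_unit.
exists (E *m invmx (P^t* )); split; last first.
  rewrite mxrankMfree ?row_free_unit ?unitmx_inv // /E rank_diag_mx.
  apply: eq_bigr => j _; rewrite mxE.
  by case: (_ < 0); rewrite ?oner_eq0 ?eqxx.
move=> v /submxP[u ->]; rewrite mulmxA => v0.
rewrite herm_form_ctr mulmxKV // herm_form_diag.
have [j uj] : exists j, (u *m E) 0 j != 0.
  apply/existsP; apply: contraNT v0; rewrite negb_exists => /forallP uE0.
  suff -> : u *m E = 0 by rewrite mul0mx.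
  by apply/matrixP => i j; rewrite ord1 [RHS]mxE; apply/eqP; have := uE0 j; rewrite negbK.
have dj : d 0 j < 0.
  by apply: contraNT uj; rewrite mul_mx_diag !mxE => /negbTE ->; rewrite mulr0.
rewrite (bigD1 j) //= ltr_wnDr //.
  apply: sumr_le0 => i _; rewrite mul_mx_diag !mxE.
  case: (boolP (d 0 i < 0)) => [di|_]; last by rewrite mulr0 normr0 expr0n mulr0.
  by rewrite nmulr_rle0 // exprn_ge0.
by rewrite nmulr_rlt0 // exprn_gt0 // normr_gt0.
Qed.

Lemma herm_spectral (C : numClosedFieldType) n (H : 'M[C]_n) : H^t* = H ->
  [/\ H = (spectralmx H)^t* *m diag_mx (spectral_diag H) *m spectralmx H,
      spectralmx H \is unitarymx &
      forall j, spectral_diag H 0 j \is Num.real].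
Proof.
move=> hH; have hs : H \is hermsymmx.
  by rewrite is_hermitianmxE expr0 scale1r hH.
split; last by move=> j; exact: (mxOverP (hermitian_spectral_diag_real hs)).
  rewrite -invmx_unitary ?spectral_unitarymx //.
  exact/orthomx_spectralP/hermitian_normalmx.
exact: spectral_unitarymx.
Qed.

Lemma neg_inertia_max (C : numClosedFieldType) m n (H : 'M[C]_n)
    (N : 'M[C]_(m, n)) :
  H^t* = H -> neg_on H N -> (\rank N <= neg_inertia H)%N.
Proof.
by move=> /herm_spectral[eH _ dR]; rewrite {1}eH; exact: neg_on_rank_le.
Qed.

Lemma neg_inertia_exists (C : numClosedFieldType) n (H : 'M[C]_n) :
  H^t* = H -> exists N : 'M[C]_n, neg_on H N /\ \rank N = neg_inertia H.
Proof.
move=> /herm_spectral[eH Pu dR].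
by have := neg_on_exists (unitarymx_unit Pu) dR; rewrite -eH.
Qed.

(** Sylvester's law of inertia: [neg_inertia] is read off a unitary diagonalisation, and
    [neg_on_rank_le] with [neg_on_exists] shows that any invertible [P] gives the same count. *)
Lemma neg_inertia_diag (C : numClosedFieldType) n (P : 'M[C]_n) (d : 'rV_n) :
  P \in unitmx -> (forall j, d 0 j \is Num.real) ->
  neg_inertia (P^t* *m diag_mx d *m P) = (\sum_j (d 0 j < 0)%R)%N.
Proof.
move=> Pu dR; set H := _ *m P.
have hH : H^t* = H.
  rewrite /H !ctrmxM trmxCK mulmxA; congr (_ *m _ *m _).
  rewrite tr_diag_mx map_diag_mx; congr diag_mx; apply/matrixP => i j.
  by rewrite !mxE ord1; exact/CrealP.
apply/eqP; rewrite eqn_leq; apply/andP; split.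
  by have [N [negN <-]] := neg_inertia_exists hH; exact: neg_on_rank_le negN.
by have [N [negN <-]] := neg_on_exists Pu dR; exact: neg_inertia_max.
Qed.

Lemma herm_congr (C : numClosedFieldType) m n (N : 'M[C]_(m, n)) (H : 'M[C]_n) :
  H^t* = H -> (N *m H *m N^t*)^t* = N *m H *m N^t*.
Proof. by move=> hH; rewrite !ctrmxM trmxCK hH mulmxA. Qed.

(** On a negative subspace of the pulled-back form [N] is injective, since that form vanishes on the
    kernel of [N]. *)
Lemma neg_inertia_pullback (C : numClosedFieldType) m n (N : 'M[C]_(m, n))
    (H : 'M[C]_n) :
  H^t* = H -> (neg_inertia (N *m H *m N^t*) <= neg_inertia H)%N.
Proof.
move=> hH; have [K [negK <-]] := neg_inertia_exists (herm_congr N hH).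
have <- : \rank (K *m N) = \rank K.
  rewrite -[RHS](mxrank_mul_ker K N).
  suff -> : (K :&: kermx N)%MS = 0 by rewrite mxrank0 addn0.
  apply/eqP; rewrite -submx0; apply/row_subP => i; set v := row i _.
  have [->|v0] := eqVneq v 0; first exact: sub0mx.
  have vK : (v <= K)%MS by rewrite (submx_trans (row_sub _ _))// capmxSl.
  have /sub_kermxP vN : (v <= kermx N)%MS.
    by rewrite (submx_trans (row_sub _ _))// capmxSr.
  have := negK _ vK v0; rewrite -herm_formM vN /herm_form !mul0mx mxE.
  by rewrite ltxx.
apply: neg_inertia_max => // v /submxP[u ->]; rewrite mulmxA => v0.
rewrite herm_formM; apply: negK; first exact: submxMl.
by apply: contraNneq v0 => ->; rewrite mul0mx.
Qed.

Lemma neg_inertia_congr (C : numClosedFieldType) n (P : 'M[C]_n) (H : 'M[C]_n) :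
  P \in unitmx -> H^t* = H -> neg_inertia (P *m H *m P^t*) = neg_inertia H.
Proof.
move=> Pu hH; apply/eqP; rewrite eqn_leq neg_inertia_pullback //=.
have := neg_inertia_pullback (invmx P) (herm_congr P hH).
by rewrite !mulmxA mulVmx // mul1mx -mulmxA -ctrmxM mulVmx // ctrmx1 mulmx1.
Qed.

Lemma neg_inertiaN (C : numClosedFieldType) n (H : 'M[C]_n) :
  H^t* = H -> (neg_inertia H + neg_inertia (- H) = \rank H)%N.
Proof.
move=> /herm_spectral[]; set P := spectralmx H; set d := spectral_diag H.
move=> -> /unitarymx_unit Pu dR.
rewrite -mulNmx -mulmxN -linearN /=.
rewrite !neg_inertia_diag // => [|j]; last by rewrite mxE realN.
rewrite mxrankMfree ?row_free_unit // -mxrank_tr trmx_mul mxrankMfree; last first.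
  by rewrite row_free_unit unitmx_tr ctrmx_unit.
rewrite mxrank_tr rank_diag_mx -big_split /=; apply: eq_bigr => j _.
rewrite mxE oppr_lt0; have := dR j; rewrite realE.
by case: (comparableP 0 (d 0 j)).
Qed.

Lemma neg_inertia_block (C : numClosedFieldType) m n (A : 'M[C]_m) (B : 'M[C]_n) :
  A^t* = A -> B^t* = B ->
  neg_inertia (block_mx A 0 0 B) = (neg_inertia A + neg_inertia B)%N.
Proof.
move=> /herm_spectral[eA PA dA] /herm_spectral[eB PB dB].
set P := spectralmx A in eA PA; set Q := spectralmx B in eB PB.
have -> : block_mx A 0 0 B = (block_mx P 0 0 Q)^t* *m
    diag_mx (row_mx (spectral_diag A) (spectral_diag B)) *m block_mx P 0 0 Q.
  rewrite diag_mx_row ctrmx_block !ctrmx0 !mulmx_block.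
  by rewrite !(mulmx0, mul0mx, addr0, add0r) -eA -eB.
rewrite neg_inertia_diag => [||j]; last first.
- by rewrite mxE; case: splitP => k _.
- by rewrite unitmxE det_ublock unitrM -!unitmxE !unitarymx_unit.
rewrite big_split_ord /=; congr (_ + _)%N; apply: eq_bigr => j _.
  by rewrite row_mxEl.
by rewrite row_mxEr.
Qed.

Lemma neg_inertia0 (C : numClosedFieldType) n : neg_inertia (0 : 'M[C]_n) = 0%N.
Proof.
have := neg_inertiaN (ctrmx0 C n n); rewrite mxrank0 => /eqP.
by rewrite addn_eq0 => /andP[/eqP].
Qed.

(** Odd powers preserve the signs of real eigenvalues. The cube arises in [neg_inertiaD] as the
    congruence of [H] by itself. *)
Lemma neg_inertia_cube (C : numClosedFieldType) n (H : 'M[C]_n) :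
  H^t* = H -> neg_inertia (H *m H *m H) = neg_inertia H.
Proof.
move=> hH; have [eH PU dR] := herm_spectral hH.
set P := spectralmx H in eH PU; set d := spectral_diag H in eH dR.
have PP : P *m P^t* = 1%:M by apply/unitarymxP.
have -> : H *m H *m H = P^t* *m diag_mx (\row_j (d 0 j) ^+ 3) *m P.
  have dE : diag_mx (\row_j (d 0 j) ^+ 3) = diag_mx d *m diag_mx d *m diag_mx d.
    apply/matrixP => i j; rewrite !mul_mx_diag !mxE.
    by case: eqVneq => [->|_]; rewrite ?mulr1n ?mulr0n ?mul0r // !exprS expr0 mulr1 mulrA.
  by rewrite dE eH !mulmxA -![_ *m P *m P^t*]mulmxA PP !mulmx1.
rewrite neg_inertia_diag ?unitarymx_unit // => [|j]; last by rewrite mxE rpredX.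
apply: eq_bigr => j _; rewrite mxE; congr nat_of_bool.
by rewrite real_exprn_odd_lt0.
Qed.

(** Two pullbacks give the two inequalities: [H + K] is the pullback of [diag(H, K)] along [(1 1)],
    and, as [H K = 0], [diag(H^3, K^3)] is the pullback of [H + K] along the column of [H] and
    [K]. *)
Lemma neg_inertiaD (C : numClosedFieldType) n (H K : 'M[C]_n) :
  H^t* = H -> K^t* = K -> H *m K = 0 ->
  neg_inertia (H + K) = (neg_inertia H + neg_inertia K)%N.
Proof.
move=> hH hK HK; have KH : K *m H = 0 by rewrite -hK -hH -ctrmxM HK ctrmx0.
have cube (L : 'M[C]_n) : L^t* = L -> (L *m L *m L)^t* = L *m L *m L.
  by move=> hL; rewrite !ctrmxM hL mulmxA.
apply/eqP; rewrite eqn_leq; apply/andP; split.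
  rewrite -neg_inertia_block //.
  have -> : H + K = row_mx 1%:M 1%:M *m block_mx H 0 0 K *m (row_mx 1%:M 1%:M)^t*.
    rewrite tr_row_mx map_col_mx !ctrmx1 mul_row_block mul_row_col.
    by rewrite !mul1mx !mulmx1 addr0 add0r.
  by apply: neg_inertia_pullback; rewrite ctrmx_block !ctrmx0 hH hK.
rewrite -(neg_inertia_cube hH) -(neg_inertia_cube hK) -neg_inertia_block ?cube //.
have -> : block_mx (H *m H *m H) 0 0 (K *m K *m K) =
    col_mx H K *m (H + K) *m (col_mx H K)^t*.
  rewrite tr_col_mx map_row_mx hH hK mul_col_mx mul_col_row !mulmxDr HK KH.
  by rewrite addr0 add0r -[H *m H *m K]mulmxA -[K *m K *m H]mulmxA HK KH !mulmx0.
by apply: neg_inertia_pullback; rewrite ctrmxD hH hK.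
Qed.

Lemma rank_ctrmx (C : numClosedFieldType) m n (A : 'M[C]_(m, n)) :
  \rank (A^t* ) = \rank A.
Proof. by rewrite mxrank_map mxrank_tr. Qed.

(** Changing the sign of the second block turns the matrix into its negative, so its rank [2 rank M]
    splits evenly between the two signs. *)
Lemma neg_inertia_hyperbolic (C : numClosedFieldType) m n (M : 'M[C]_(m, n)) :
  neg_inertia (block_mx 0 M (M^t* ) 0) = \rank M.
Proof.
set H := block_mx _ _ _ _.
have hH : H^t* = H by rewrite /H ctrmx_block trmxCK !ctrmx0.
pose P : 'M[C]_(m + n) := block_mx 1%:M 0 0 (- 1%:M).
have PP : P *m P = 1%:M.
  rewrite mulmx_block !(mulmx0, mul0mx, addr0, add0r) mulNmx mulmxN opprK !mulmx1.
  by rewrite scalar_mx_block.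
have PHP : P *m H *m P^t* = - H.
  rewrite ctrmx_block ctrmxN !ctrmx0 !ctrmx1 !mulmx_block.
  rewrite !(mulmx0, mul0mx, addr0, add0r, mulmx1, mul1mx, mulmxN, mulNmx).
  by rewrite opp_block_mx !oppr0.
have rH : \rank H = (\rank M + \rank M)%N.
  have -> : H = block_mx M 0 0 (M^t* ) *m block_mx 0 1%:M 1%:M 0.
    by rewrite mulmx_block !(mulmx0, mul0mx, addr0, add0r, mulmx1).
  rewrite mxrankMfree ?rank_diag_block_mx ?rank_ctrmx //.
  apply/row_freeP; exists (block_mx 0 1%:M 1%:M 0).
  by rewrite mulmx_block !(mulmx0, mul0mx, addr0, add0r, mulmx1) scalar_mx_block.
have := neg_inertiaN hH.
rewrite -PHP neg_inertia_congr //; last by have [] := mulmx1_unit PP.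
by rewrite rH !addnn => /double_inj.
Qed.

Lemma unitmx_lblock1 (C : numClosedFieldType) m n (X : 'M[C]_(n, m)) :
  block_mx 1%:M 0 X 1%:M \in unitmx.
Proof. by rewrite unitmxE det_lblock !det1 mulr1 unitr1. Qed.

(** The off-diagonal block factors through [Q]; elimination with [L] takes the place of division by
    [Q]. *)
Lemma neg_inertia_schur (C : numClosedFieldType) m n (Q : 'M[C]_m)
    (L : 'M[C]_(m, n)) (W : 'M[C]_n) : Q^t* = Q -> W^t* = W ->
  neg_inertia (block_mx Q (Q *m L) (L^t* *m Q) W) =
  (neg_inertia Q + neg_inertia (W - L^t* *m Q *m L))%N.
Proof.
move=> hQ hW; rewrite -neg_inertia_block //; last first.
  by rewrite ctrmxD ctrmxN !ctrmxM trmxCK hQ hW mulmxA.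
rewrite -(neg_inertia_congr (unitmx_lblock1 (- L^t* ))); last first.
  by rewrite ctrmx_block !ctrmxM trmxCK hQ hW.
congr neg_inertia; rewrite ctrmx_block !ctrmx0 !ctrmx1 ctrmxN trmxCK !mulmx_block.
rewrite !(mulmx0, mul0mx, addr0, add0r, mulmx1, mul1mx, mulmxN, mulNmx).
by rewrite !addNr mul0mx oppr0 add0r mulmxA [- _ + W]addrC.
Qed.

(* Haynsworth inertia additivity with a singular corner [A]: the part of [B]
   leaving the range of [A] contributes hyperbolic planes. *)
Lemma neg_inertia_schur_pinv (C : numClosedFieldType) n (A A' B D M M' : 'M[C]_n) :
  A^t* = A -> A'^t* = A' -> D^t* = D ->
  A *m A' *m A = A -> A' *m A *m A' = A' -> (A *m A')^t* = A *m A' ->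
  M = (1%:M - A *m A') *m B ->
  M *m M' *m M = M -> M' *m M *m M' = M' ->
  (M *m M')^t* = M *m M' -> (M' *m M)^t* = M' *m M ->
  let V : 'M[C]_n := 1%:M - M' *m M in
  neg_inertia (block_mx A B (B^t* ) D) =
  (neg_inertia A + \rank M
     + neg_inertia (V *m (D - B^t* *m A' *m B) *m V))%N.
Proof.
move=> hA hA' hD AA'A A'AA' hAA' eM MM'M M'MM' hMM' hM'M V.
pose T : 'M[C]_n := 1%:M - A *m A'.
have [D' eD'] : {D' | D' = D - B^t* *m A' *m B} by eexists.
have A'A : A' *m A = A *m A' by rewrite -hAA' ctrmxM hA hA'.
have AT : A *m T = 0 by rewrite mulmxBr mulmx1 -A'A mulmxA AA'A subrr.
have TA : T *m A = 0 by rewrite mulmxBl mul1mx AA'A subrr.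
have A'T : A' *m T = 0 by rewrite mulmxBr mulmx1 mulmxA A'AA' subrr.
have hT : T^t* = T by rewrite ctrmxD ctrmxN ctrmx1 hAA'.
have TT : T *m T = T by rewrite {1}/T mulmxBl mul1mx -mulmxA A'T mulmx0 subr0.
have hV : V^t* = V by rewrite ctrmxD ctrmxN ctrmx1 hM'M.
have hD' : D'^t* = D' by rewrite eD' ctrmxD ctrmxN !ctrmxM trmxCK hA' hD mulmxA.
have MV : M *m V = 0 by rewrite mulmxBr mulmx1 mulmxA MM'M subrr.
have TM : T *m M = M by rewrite eM mulmxA TT.
have AM : A *m M = 0 by rewrite -TM mulmxA AT mul0mx.
(* [L] is built to satisfy [A L = 0] and [M^* L + L^* M = D' - V D' V]. With [U = M' M = 1 - V] the
   right-hand side is [U D' V + V D' U + U D' U]; the last term is shared equally by the two adjoint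
   summands, whence the factor one half. *)
pose Z : 'M[C]_n := D' *m V + 2^-1 *: (D' *m (M' *m M)); pose L := M'^t* *m Z.
have AL : A *m L = 0.
  have -> : L = T *m (M *m (M' *m M'^t* )) *m Z.
    rewrite [T *m (M *m _)]mulmxA TM /L; congr (_ *m _).
    by rewrite -[in LHS]M'MM' -mulmxA ctrmxM hMM' !mulmxA.
  by rewrite !mulmxA AT !mul0mx.
have TL : T *m L = L.
  by rewrite mulmxBl mul1mx -A'A -mulmxA AL mulmx0 subr0.
have MsMs : M^t* *m M'^t* = M' *m M by rewrite -ctrmxM.
have ML : M^t* *m L + L^t* *m M = D' - V *m D' *m V.
  have [U eU] : {U | U = M' *m M} by exists (M' *m M).
  have eV : V = 1%:M - U by rewrite eU.
  have hU : U^t* = U by rewrite eU.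
  have -> : L^t* *m M = (M^t* *m L)^t* by rewrite ctrmxM trmxCK.
  have -> : M^t* *m L = U *m D' *m V + 2^-1 *: (U *m D' *m U).
    by rewrite /L /Z mulmxA MsMs -eU mulmxDr -scalemxAr !mulmxA.
  rewrite ctrmxD ctrmxZ !ctrmxM hV hU hD' fmorphV rmorph_nat !mulmxA addrACA.
  rewrite -scalerDl -div1r -splitr scale1r eV !mulmxBl !mulmxBr !mul1mx !mulmx1.
  by rewrite -addrA subrK opprB opprB addrCA [D' + _]addrC subrK.
(* [A' B] removes from [B] its part in the range of [A] and leaves [M]; [L] compresses the lower
   corner to the range of [V]. The result is the sum of [diag(A, V D' V)] and a hyperbolic matrix,
   which annihilate each other because [A M = 0] and [M V = 0]. *)
pose X := - (A' *m B + L)^t*.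
have hX : X^t* = - (A' *m B + L) by rewrite ctrmxN trmxCK.
rewrite -(neg_inertia_congr (unitmx_lblock1 X)); last first.
  by rewrite ctrmx_block trmxCK hA hD.
have AXB : A *m X^t* + B = M.
  by rewrite hX mulmxN mulmxDr AL addr0 eM mulmxBl mul1mx mulmxA addrC.
have XA : X *m A = M^t* - B^t*.
  by rewrite -AXB ctrmxD ctrmxM trmxCK hA addrK.
have P3 : block_mx 1%:M 0 X 1%:M *m block_mx A B (B^t* ) D *m
    (block_mx 1%:M 0 X 1%:M)^t* = block_mx A 0 0 (V *m D' *m V) + block_mx 0 M (M^t* ) 0.
  rewrite add_block_mx !(addr0, add0r).
  rewrite ctrmx_block !ctrmx0 !ctrmx1 !mulmx_block.
  rewrite !(mulmx0, mul0mx, addr0, add0r, mulmx1, mul1mx) AXB XA subrK.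
  congr block_mx.
  have MX : M^t* *m X^t* = - (M^t* *m L).
    rewrite hX mulmxN mulmxDr; congr (- _); rewrite -TM ctrmxM hT mulmxA.
    rewrite -[M^t* *m T *m A']mulmxA -[in T *m A']hT -[in _ *m A']hA' -ctrmxM A'T.
    by rewrite ctrmx0 mulmx0 mul0mx add0r.
  have XB : X *m B = - (B^t* *m A' *m B) - L^t* *m M.
    rewrite /X ctrmxD mulNmx mulmxDl opprD ctrmxM hA'; congr (_ - _).
    have eMT : M = T *m B by [].
    by rewrite eMT mulmxA -[T in RHS]hT -ctrmxM TL.
  rewrite MX XB -[V *m _ *m V](subKr D') -ML opprD eD'.
  by rewrite addrCA [RHS]addrACA [RHS]addrC [D + _]addrC.
rewrite P3 -eD' neg_inertiaD.
- rewrite neg_inertia_hyperbolic neg_inertia_block //; last by rewrite !ctrmxM hV hD' mulmxA.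
  by rewrite addnAC.
- by rewrite ctrmx_block !ctrmx0 hA !ctrmxM hV hD' mulmxA.
- by rewrite ctrmx_block !ctrmx0 trmxCK.
- rewrite mulmx_block !(mulmx0, mul0mx, addr0, add0r) AM.
  have -> : V *m D' *m V *m M^t* = (M *m V *m (D' *m V))^t*.
    by rewrite !ctrmxM hV hD' !mulmxA.
  by rewrite MV mul0mx ctrmx0 block_mx0.
Qed.

(** The matrix [[[Q, v], [v^*, 0]]] is evaluated twice. Since [v = Q L], its Schur complement is
    [D + D A D]. Since the lower block [F^*] of [v] is invertible, [v] also clears every block of
    [Q] except [D], leaving [ind D] and a hyperbolic part of rank [n]. *)
Lemma neg_inertia_graph (C : numClosedFieldType) n (D A : 'M[C]_n) :
  D^t* = D -> A^t* = A -> 1%:M + D *m A \in unitmx ->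
  (neg_inertia (D + D *m A *m D) + neg_inertia (block_mx D 1%:M 1%:M (- A)) =
   neg_inertia D + n)%N.
Proof.
move=> hD hA uF; set F := 1%:M + D *m A in uF.
set Q := block_mx D _ _ _; pose v : 'M[C]_(n + n, n) := col_mx 0 (F^t* ).
have hQ : Q^t* = Q by rewrite ctrmx_block ctrmxN ctrmx1 hD hA.
have eF : F^t* = 1%:M + A *m D by rewrite ctrmxD ctrmx1 ctrmxM hD hA.
pose L : 'M[C]_(n + n, n) := col_mx 1%:M (- D).
have QL : Q *m L = v.
  by rewrite /v eF mul_block_col !mulmx1 mul1mx subrr mulNmx mulmxN opprK.
have LQ : L^t* *m Q = v^t* by rewrite -QL ctrmxM hQ.
have := neg_inertia_schur L hQ (ctrmx0 C n n).
have -> : 0 - L^t* *m Q *m L = D + D *m A *m D.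
  rewrite LQ /v tr_col_mx map_row_mx trmxCK ctrmx0 mul_row_col mul0mx add0r.
  by rewrite mulmxN sub0r opprK mulmxDl mul1mx.
rewrite QL LQ [RHS]addnC => schurE; rewrite -schurE => {schurE}.
(* Chosen so that [X v^* + v X^*] cancels the two borders 1 and the corner [- A] of [Q]; each of the
   two terms supplies half of [A]. *)
pose c := invmx F; pose X : 'M[C]_(n + n, n) := col_mx (- c) (2^-1 *: (A *m c)).
have uP : block_mx 1%:M X 0 1%:M \in unitmx.
  by rewrite unitmxE det_ublock !det1 mulr1 unitr1.
have hB : (block_mx Q v (v^t* ) 0)^t* = block_mx Q v (v^t* ) 0.
  by rewrite ctrmx_block trmxCK ctrmx0 hQ.
rewrite -(neg_inertia_congr uP hB).
have cF : c *m F = 1%:M by rewrite mulVmx.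
have Xv : X *m v^t* = block_mx 0 (- 1%:M) 0 (2^-1 *: A).
  rewrite /v tr_col_mx map_row_mx trmxCK ctrmx0 mul_col_row !mulmx0.
  by rewrite mulNmx -scalemxAl -mulmxA cF mulmx1.
have vX : v *m X^t* = block_mx 0 0 (- 1%:M) (2^-1 *: A).
  rewrite -[v]trmxCK -ctrmxM Xv ctrmx_block ctrmxN ctrmxZ ctrmx1 !ctrmx0 hA.
  by rewrite fmorphV rmorph_nat.
have -> : block_mx 1%:M X 0 1%:M *m block_mx Q v (v^t* ) 0 *m (block_mx 1%:M X 0 1%:M)^t* =
    block_mx (block_mx D 0 0 0) 0 0 0 + block_mx 0 v (v^t* ) 0.
  rewrite add_block_mx !(addr0, add0r) ctrmx_block !ctrmx0 !ctrmx1 !mulmx_block.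
  rewrite !(mulmx0, mul0mx, addr0, add0r, mulmx1, mul1mx); congr block_mx.
  rewrite Xv vX !add_block_mx !addr0 !subrr; congr block_mx.
  by rewrite -addrA -scalerDl -div1r -splitr scale1r addNr.
have hD0 : (block_mx D 0 0 0 : 'M[C]_(n + n))^t* = block_mx D 0 0 0.
  by rewrite ctrmx_block !ctrmx0 hD.
rewrite neg_inertiaD.
- rewrite neg_inertia_hyperbolic !neg_inertia_block ?ctrmx0 // !neg_inertia0 !addn0.
  congr (_ + _)%N; rewrite /v -addsmxE adds0mx.
  by apply: mxrank_unit; rewrite ctrmx_unit.
- by rewrite ctrmx_block !ctrmx0 hD0.
- by rewrite ctrmx_block !ctrmx0 trmxCK.
- rewrite mulmx_block !(mulmx0, mul0mx, addr0, add0r).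
  by rewrite /v mul_block_col !(mulmx0, mul0mx, addr0, add0r) col_mx0 block_mx0.
Qed.

(** * Lower semicontinuity of the inertia, and its value on a block matrix of differences *)

Lemma herm_form_real (C : numClosedFieldType) n (H : 'M[C]_n) v :
  H^t* = H -> herm_form H v \is Num.real.
Proof.
move=> hH; apply/CrealP; rewrite /herm_form.
have : (v *m H *m v^t* )^t* = v *m H *m v^t* by exact: herm_congr.
by move: (v *m H *m _) => A /matrixP/(_ 0 0); rewrite !mxE.
Qed.

Lemma herm_form_le (C : numClosedFieldType) n (H : 'M[C]_n) c v :
  (forall i j, `|H i j| <= c) ->
  `|herm_form H v| <= c * n%:R * \sum_j `|v 0 j| ^+ 2.
Proof.
move=> Hc; set S := \sum_j _.
have -> : herm_form H v = \sum_j \sum_i v 0 i * H i j * (v 0 j)^*.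
  rewrite /herm_form mxE; apply: eq_bigr => j _.
  by rewrite mxE mulr_suml; apply: eq_bigr => i _; rewrite !mxE.
apply: (@le_trans _ _ (\sum_j \sum_i c / 2 * (`|v 0 i| ^+ 2 + `|v 0 j| ^+ 2))).
  apply: (le_trans (ler_norm_sum _ _ _)); apply: ler_sum => j _.
  apply: (le_trans (ler_norm_sum _ _ _)); apply: ler_sum => i _.
  rewrite !normrM norm_conjC mulrAC [_ * `|H i j|]mulrC -mulrA.
  have am : `|v 0 i| * `|v 0 j| <= 2^-1 * (`|v 0 i| ^+ 2 + `|v 0 j| ^+ 2).
    rewrite ler_pdivlMl ?ltr0n // -subr_ge0.
    have -> : `|v 0 i| ^+ 2 + `|v 0 j| ^+ 2 - 2 * (`|v 0 i| * `|v 0 j|) =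
              (`|v 0 i| - `|v 0 j|) ^+ 2.
      by rewrite sqrrB mulr_natl addrAC.
    by rewrite real_exprn_even_ge0 // rpredB // normr_real.
  by apply: ler_pM => //; rewrite mulr_ge0.
rewrite (eq_bigr (fun j => c / 2 * (S + n%:R * `|v 0 j| ^+ 2))) => [|j _]; last first.
  by rewrite -mulr_sumr big_split /= sumr_const card_ord mulr_natl.
rewrite -mulr_sumr big_split /= sumr_const card_ord -mulr_sumr -/S -[S *+ n]mulr_natl.
by rewrite -mulr2n -[_ * S *+ 2]mulr_natl !mulrA divfK ?pnatr_eq0.
Qed.

(** On the negative eigenspace of [H] the form is at most [- c |v|^2], while a perturbation with
    entries bounded by [c / (n + 1)] changes it by less than [c |v|^2]. The same subspace thus stays
    negative for [K]. *)
Lemma neg_inertia_open (C : numClosedFieldType) n (H : 'M[C]_n) : H^t* = H ->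
  exists2 c, 0 < c & forall K : 'M[C]_n, K^t* = K ->
    (forall i j, `|K i j - H i j| <= c) -> (neg_inertia H <= neg_inertia K)%N.
Proof.
move=> hH; have [eH PU dR] := herm_spectral hH.
set P := spectralmx H in eH PU; set d := spectral_diag H in eH dR.
(* The reciprocal of a sum of reciprocals bounds every [|d_j|] with [d_j < 0] from below; adding 1
   keeps [c] defined when there is no negative eigenvalue. *)
pose a := \sum_(j | d 0 j < 0) (- d 0 j)^-1.
have a0 : 0 <= a by apply: sumr_ge0 => j dj; rewrite invr_ge0 oppr_ge0 ltW.
pose c := (a + 1)^-1.
have c0 : 0 < c by rewrite invr_gt0 ltr_wpDl.
have dc j : d 0 j < 0 -> d 0 j <= - c.
  move=> dj; rewrite lerNr -[- d 0 j]invrK lef_pV2 ?posrE; last 2 first.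
  - by rewrite ltr_wpDl.
  - by rewrite invr_gt0 oppr_gt0.
  rewrite /a (bigD1 j) //= -addrA lerDl addr_ge0 // sumr_ge0 // => i /andP[di _].
  by rewrite invr_ge0 oppr_ge0 ltW.
exists (c / n.+1%:R); first by rewrite divr_gt0 ?ltr0n.
move=> K hK KH; pose E : 'M[C]_n := diag_mx (\row_j (d 0 j < 0)%R%:R).
have -> : neg_inertia H = \rank (E *m P).
  rewrite mxrankMfree ?row_free_unit ?unitarymx_unit // rank_diag_mx.
  by apply: eq_bigr => j _; rewrite mxE -/d; case: (_ < 0); rewrite ?oner_eq0 ?eqxx.
apply: neg_inertia_max => // v /submxP[u ->]; rewrite mulmxA; set w := u *m E => v0.
have [j0 wj0] : exists j, w 0 j != 0.
  apply/existsP; apply: contraNT v0; rewrite negb_exists => /forallP w0.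
  suff -> : w = 0 by rewrite mul0mx.
  by apply/matrixP => i j; rewrite ord1 [RHS]mxE; apply/eqP; have := w0 j; rewrite negbK.
have wS : \sum_j `|(w *m P) 0 j| ^+ 2 = \sum_j `|w 0 j| ^+ 2.
  have sq (x : 'rV[C]_n) : \sum_j `|x 0 j| ^+ 2 = herm_form 1%:M x.
    rewrite -diag_const_mx herm_form_diag; apply: eq_bigr => j _.
    by rewrite mxE mul1r.
  by rewrite !sq herm_formM mulmx1 (unitarymxP PU).
set S := \sum_j `|w 0 j| ^+ 2 in wS.
have S0 : 0 < S.
  rewrite /S (bigD1 j0) //= ltr_wpDr ?exprn_gt0 ?normr_gt0 //.
  by apply: sumr_ge0 => j _; rewrite exprn_ge0.
have HS : herm_form H (w *m P) <= - c * S.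
  rewrite eH herm_form_ctr -mulmxA (unitarymxP PU) mulmx1 herm_form_diag mulr_sumr.
  apply: ler_sum => j _; rewrite /w mul_mx_diag !mxE.
  case: (boolP (d 0 j < 0)) => [dj|_]; last by rewrite mulr0 normr0 expr0n !mulr0.
  by rewrite ler_wpM2r ?dc // exprn_ge0.
have -> : herm_form K (w *m P) = herm_form H (w *m P) + herm_form (K - H) (w *m P).
  rewrite /herm_form mulmxBr mulmxBl; set A := _ *m K *m _; set B := _ *m H *m _.
  by move: A B => A B; rewrite !mxE [RHS]addrC subrK.
have KHR : herm_form (K - H) (w *m P) \is Num.real.
  by apply: herm_form_real; rewrite ctrmxD ctrmxN hK hH.
have KS : herm_form (K - H) (w *m P) <= c / n.+1%:R * n%:R * S.
  rewrite -wS; apply: (le_trans (real_ler_norm KHR)).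
  by apply: herm_form_le => i j; rewrite !mxE.
apply: (le_lt_trans (lerD HS KS)); rewrite -mulrDl pmulr_llt0 // addrC subr_lt0.
by rewrite -mulrA gtr_pMr // mulrC ltr_pdivrMr ?ltr0n // mul1r ltr_nat.
Qed.

(** Elimination from the lower right corner: once [X] and [X'] are removed by congruence, adding the
    second block row and column to the first turns [[[- N', N], [N, - N]]] into
    [diag(N - N', - N)]. *)
Lemma neg_inertia_difference (C : numClosedFieldType) n (N N' X X' : 'M[C]_n) :
  N^t* = N -> N'^t* = N' -> X \in unitmx -> X' \in unitmx ->
  neg_inertia (block_mx (X'^t* *m (- N') *m X') (X'^t* *m N *m X)
                        (X^t* *m N *m X') (X^t* *m (- N) *m X)) =
  (neg_inertia (N - N') + neg_inertia (- N))%N.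
Proof.
move=> hN hN' uX uX'.
have hD : (N - N')^t* = N - N' by rewrite ctrmxD ctrmxN hN hN'.
have hNN : (- N)^t* = - N by rewrite ctrmxN hN.
pose S' := block_mx (X'^t* ) (- X'^t* ) 0 (X^t* ).
have uS' : S' \in unitmx.
  by rewrite unitmxE det_ublock unitrM -!unitmxE !ctrmx_unit uX uX'.
rewrite -neg_inertia_block // -[RHS](neg_inertia_congr uS'); last first.
  by rewrite ctrmx_block !ctrmx0 hD hNN.
rewrite /S' ctrmx_block ctrmxN !ctrmx0 !trmxCK !mulmx_block.
rewrite !(mulmx0, mul0mx, addr0, add0r); congr (neg_inertia (block_mx _ _ _ _)).
- rewrite !(mulmxN, mulNmx) opprK mulmxBr mulmxBl.
  by rewrite addrAC subrr add0r.
- by rewrite !mulmxN !mulNmx opprK.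
- by rewrite !mulmxN !mulNmx opprK.
Qed.

Local Notation cmx := (map_mx (real_complex _)).

Lemma neg_inertiaZ (C : numClosedFieldType) n (c : C) (H : 'M[C]_n) :
  0 < c -> H^t* = H -> neg_inertia (c *: H) = neg_inertia H.
Proof.
move=> c0 /herm_spectral[eH PU dR].
have -> : c *: H =
    (spectralmx H)^t* *m diag_mx (c *: spectral_diag H) *m spectralmx H.
  by rewrite linearZ /= -scalemxAr -scalemxAl -eH.
rewrite neg_inertia_diag ?unitarymx_unit // => [|j].
  by apply: eq_bigr => j _; rewrite mxE pmulr_rlt0.
by rewrite mxE realM // gtr0_real.
Qed.

(** * Eigenvalue counts *)

(** Reduces the sums over infinite sets in [neg_index] and [arc_count] to counts over a finite
    family of eigenvalues or angles [r]. *)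
Lemma fsbig_count (T : choiceType) n (r : 'I_n -> T) (A : set T) (f : T -> nat) :
  (forall x, A x -> f x = (\sum_j (r j == x))%N) ->
  \sum_(x \in A) f x = (\sum_j (r j \in A))%N.
Proof.
move=> fE; pose s := [seq x <- undup (codom r) | x \in A].
have us : uniq s by rewrite filter_uniq // undup_uniq.
rewrite (fsbigE s) //; last 2 first.
- by move=> x /=; rewrite mem_filter => /andP[/set_mem].
- move=> x Ax xs; rewrite fE // big1 // => j _; apply/eqP.
  rewrite eqb0; apply: contraNN xs => /eqP rjx.
  by rewrite -rjx mem_filter mem_undup codom_f andbT rjx; exact/mem_set.
transitivity (\sum_(i <- s | i \in A) f i)%N; first by [].
rewrite (eq_bigr (fun i => (\sum_j (r j == i)%N)%N)) => [|i /set_mem/fE//].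
rewrite exchange_big /=; apply: eq_bigr => j _.
have [rjA|rjA] := boolP (r j \in A); last first.
  rewrite big1 // => i iA; apply/eqP; rewrite eqb0.
  by apply: contraNneq rjA => ->.
have rjs : r j \in s by rewrite mem_filter rjA mem_undup codom_f.
rewrite big_mkcond (bigD1_seq (r j)) //= rjA eqxx big1 // => i irj.
by rewrite eq_sym (negbTE irj) if_same.
Qed.

Lemma conj_real_complex (R : realType) (x : R) : (x%:C)%C^* = (x%:C)%C.
Proof. by apply: conj_Creal; apply/complex_realP; exists x. Qed.

Lemma ctrmx_real (R : realType) m n (A : 'M[R]_(m, n)) :
  (map_mx (real_complex R) A)^t* = map_mx (real_complex R) A^T.
Proof. by apply/matrixP => i j; rewrite !mxE conj_real_complex. Qed.

Lemma char_poly_unitary (C : numClosedFieldType) n (P : 'M[C]_n) (d : 'rV_n) :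
  P \is unitarymx ->
  char_poly (P^t* *m diag_mx d *m P) = \prod_j ('X - (d 0 j)%:P).
Proof.
move=> PU; have PsP : P^t* *m P = 1%:M by apply: mulmx1C; apply/unitarymxP.
have -> : \prod_j ('X - (d 0 j)%:P) = char_poly (diag_mx d).
  rewrite char_poly_trig ?diag_mx_is_trig //; apply: eq_bigr => j _.
  by rewrite mxE eqxx mulr1n.
have PsP' : map_mx polyC (P^t* ) *m map_mx polyC P = 1%:M.
  by rewrite -map_mxM PsP map_mx1.
rewrite /char_poly /char_poly_mx !map_mxM.
have -> : 'X%:M - map_mx polyC (P^t* ) *m map_mx polyC (diag_mx d) *m map_mx polyC P =
    map_mx polyC (P^t* ) *m ('X%:M - map_mx polyC (diag_mx d)) *m map_mx polyC P.
  by rewrite mulmxBr mulmxBl scalar_mxC -[_%:M *m _ *m _]mulmxA PsP' mulmx1.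
rewrite !det_mulmx mulrAC -det_mulmx PsP' det1 mul1r.
by [].
Qed.

Lemma mup_prod_XsubC (F : fieldType) n (r : 'I_n -> F) (x : F) :
  mup x (\prod_j ('X - (r j)%:P)) = (\sum_j (r j == x))%N.
Proof.
suff [] : \prod_j ('X - (r j)%:P) != 0 /\
    mup x (\prod_j ('X - (r j)%:P)) = (\sum_j (r j == x))%N by [].
apply: (big_ind2 (fun (p : {poly F}) k => p != 0 /\ mup x p = k)).
- by rewrite oner_neq0 mupNroot // /root hornerC oner_eq0.
- by move=> p k q l [p0 <-] [q0 <-]; rewrite mulf_neq0 // mupM.
- move=> j _; rewrite polyXsubC_eq0; split=> //.
  by rewrite -['X - _]expr1 mup_XsubCX; case: eqP.
Qed.

(** The complex spectral values of a real symmetric matrix are real, so the factorisation of the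
    characteristic polynomial that they give descends to [R]. *)
Lemma neg_index_inertia (R : realType) n (P : 'M[R]_n) :
  P^T = P -> neg_index P = neg_inertia (map_mx (real_complex R) P).
Proof.
move=> hP; set H := map_mx _ P.
have hH : H^t* = H by rewrite ctrmx_real hP.
have [eH PU dR] := herm_spectral hH.
set U := spectralmx H in eH PU; set d := spectral_diag H in eH dR.
pose r j := complex.Re (d 0 j).
have dE j : d 0 j = ((r j)%:C)%C by rewrite RRe_real.
have eP : char_poly P = \prod_j ('X - (r j)%:P).
  apply: (map_poly_inj (real_complex R)).
  rewrite map_char_poly -/H eH char_poly_unitary // rmorph_prod.
  by apply: eq_bigr => j _; rewrite rmorphB /= map_polyX map_polyC /= -dE.
rewrite /neg_index (fsbig_count (r := r)) => [|x _]; last first.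
  by rewrite eP mup_prod_XsubC.
apply: eq_bigr => j _; rewrite -/d dE; congr nat_of_bool.
have -> : ((r j)%:C%C < 0) = (r j < 0) by exact: (ltcR (r j) 0).
by apply/idP/idP => [/set_mem//|?]; exact/mem_set.
Qed.

Lemma expi_inj (R : realType) (x y : R) :
  0 <= x < 2 * pi -> 0 <= y < 2 * pi -> expi x = expi y -> x = y.
Proof.
move=> /andP[x0 x2] /andP[y0 y2] [cE sE].
wlog xy : x y x0 x2 y0 y2 cE sE / x <= y.
  by move=> h; have [|/ltW] := leP x y => xy; [|symmetry]; apply: h.
apply/eqP; rewrite eq_le xy /= leNgt; apply/negP => xlty.
have s0 : 0 < sin ((y - x) / 2) by apply: sin_gt0_pi; apply/andP; split; lra.
have : cos (y - x) = 1 by rewrite cosB cE sE -!expr2 cos2Dsin2.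
have -> : y - x = (y - x) / 2 *+ 2 by rewrite -mulr_natr divfK.
rewrite cos_mulr2n cos2sin2 => h.
have /eqP : sin ((y - x) / 2) ^+ 2 = 0 by move: h; rewrite -mulr_natr; lra.
by rewrite sqrf_eq0 gt_eqF.
Qed.

Lemma expi_surj (R : realType) (z : R[i]) :
  z * z^* = 1 -> exists2 x, 0 <= x < 2 * pi & expi x = z.
Proof.
case: z => u v zz; have uv : u ^+ 2 + v ^+ 2 = 1.
  by case: zz => <- _; rewrite mulrN opprK !expr2.
have u1 : -1 <= u <= 1 by apply/andP; split; nra.
have piP := pi_gt0 R.
have /andP[a0 api] : 0 <= acos u <= pi by rewrite acos_ge0 // acos_lepi.
have sa : sin (acos u) = `|v|.
  by rewrite sin_acos // -uv addrAC subrr add0r sqrtr_sqr.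
have ca : cos (acos u) = u by rewrite acosK // in_itv.
have [v0|v0] := leP 0 v.
  exists (acos u); first by lra.
  by rewrite /expi ca sa ger0_norm.
exists (2 * pi - acos u).
  have : acos u != 0.
    by apply: contraTneq v0 => a0'; move: sa; rewrite a0' sin0 => /esym/normr0_eq0->; rewrite ltxx.
  by move=> /eqP; lra.
rewrite /expi mulrC mulr_natr cosB sinB cos2pi sin2pi.
by rewrite !mul1r !mul0r addr0 sub0r ca sa ltr0_norm // opprK.
Qed.

Lemma expiD_pi (R : realType) (x : R) : expi (pi + x) = - expi x.
Proof. by rewrite /expi addrC cosDpi sinDpi. Qed.

Lemma conj_expi (R : realType) (x : R) : (expi x)^* = expi (- x).
Proof. by rewrite /expi cosN sinN. Qed.

Lemma expiD (R : realType) (x y : R) : expi (x + y) = expi x * expi y.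
Proof.
rewrite /expi cosD sinD [RHS]/GRing.mul /=; congr Complex.
by rewrite addrC [cos x * _]mulrC mulrC [sin x * _]mulrC.
Qed.

Lemma expi0 (R : realType) : expi (0 : R) = 1.
Proof. by rewrite /expi cos0 sin0. Qed.

(* The Hermitian form below takes the value [4 sin (x / 2) sin ((e - x) / 2)]
   at the eigenvalue [expi x]; it is negative exactly off the arc [0, e]. *)
Lemma arc_form_expi (R : realType) (e x : R) (q := expi (e / 2)) :
  q^* * (expi x - 1) + q * ((expi x)^* - 1) =
  ((4 * (sin (x / 2) * sin ((e - x) / 2)))%:C)%C.
Proof.
have -> : expi x = expi (x / 2) * expi (x / 2) by rewrite -expiD -splitr.
have -> : sin ((e - x) / 2) = sin (e / 2) * cos (x / 2) - cos (e / 2) * sin (x / 2).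
  by rewrite mulrBl sinB.
have := cos2Dsin2 (x / 2).
rewrite /q !rmorphM !conj_expi /expi !sinN !cosN.
set c := cos (x / 2); set s := sin (x / 2); set C := cos (e / 2); set S := sin (e / 2).
move=> cs; apply/eqP; rewrite eq_complex /=; apply/andP; split; apply/eqP.
  have -> : c * c = 1 - s * s by rewrite -cs; ring.
  by ring.
by ring.
Qed.

Lemma arc_form_lt0 (R : realType) (e x : R) : 0 < e < pi -> 0 <= x < 2 * pi ->
  (4 * (sin (x / 2) * sin ((e - x) / 2)) < 0) = (e < x).
Proof.
move=> /andP[e0 epi] /andP[x0 x2]; rewrite pmulr_rlt0 //.
have [->|x0'] := eqVneq x 0.
  by rewrite mul0r sin0 mul0r ltxx; apply/esym/negbTE; rewrite -leNgt ltW.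
have {x0' x0} x0 : 0 < x by rewrite lt_def x0'.
have sx : 0 < sin (x / 2) by apply: sin_gt0_pi; apply/andP; split; lra.
rewrite pmulr_rlt0 //.
have [ex|ex|->] := ltgtP e x; last by rewrite subrr mul0r sin0 ltxx.
  rewrite -oppr_gt0 -sinN; apply: sin_gt0_pi; apply/andP; split; lra.
apply/negbTE; rewrite -leNgt ltW //; apply: sin_gt0_pi; apply/andP; split; lra.
Qed.

(** [G] is diagonalised unitarily with eigenvalues [expi (psi j)], [0 <= psi j < 2 pi]. The sign in
    [- G] absorbs the shift by [pi], so the arc counts the [psi j < e]; by [arc_form_lt0] the form
    counts the [psi j > e]; equality is excluded by the invertibility hypothesis. *)
Lemma arc_count_inertia (R : realType) n (G : 'M[R[i]]_n) (e : R)
    (q := expi (e / 2)) :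
  0 < e < pi -> G *m G^t* = 1%:M -> G - (expi e)%:M \in unitmx ->
  (arc_count (- G) e +
   neg_inertia (q^* *: (G - 1%:M) + q *: (G^t* - 1%:M)))%N = n.
Proof.
move=> epi GG Gu; have GsG := mulmx1C GG.
have Gn : G \is normalmx by apply/normalmxP; rewrite GG GsG.
have PU := spectral_unitarymx G; have Pu := unitarymx_unit PU.
have eG : G = (spectralmx G)^t* *m diag_mx (spectral_diag G) *m spectralmx G.
  by rewrite -invmx_unitary //; exact/orthomx_spectralP.
set P := spectralmx G in PU Pu eG; set z := spectral_diag G in eG.
have PP : P *m P^t* = 1%:M by apply/unitarymxP.
have PsP : P^t* *m P = 1%:M by apply: mulmx1C.
have zz j : z 0 j * (z 0 j)^* = 1.
  have : diag_mx z *m (diag_mx z)^t* = 1%:M.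
    have -> : diag_mx z = P *m G *m P^t*.
      by rewrite eG !mulmxA PP mul1mx -mulmxA PP mulmx1.
    rewrite !ctrmxM trmxCK !mulmxA -[_ *m P^t* *m P]mulmxA PsP mulmx1.
    by rewrite -[_ *m G *m _]mulmxA GG mulmx1 PP.
  by move/matrixP => /(_ j j); rewrite tr_diag_mx map_diag_mx mul_mx_diag !mxE eqxx !mulr1n.
have /choice[psi psiP] : forall j, exists x : R, 0 <= x < 2 * pi /\ expi x = z 0 j.
  by move=> j; have [x] := expi_surj (zz j); exists x.
have subE (w : R[i]) : G - w%:M = P^t* *m diag_mx (z - const_mx w) *m P.
  rewrite linearB /= mulmxBr mulmxBl -eG diag_const_mx scalar_mxC -mulmxA PsP.
  by rewrite mulmx1.
have rkE (w : R[i]) : \rank (G - w%:M) = (\sum_j (z 0 j != w)%R)%N.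
  rewrite subE mxrankMfree ?row_free_unit // -mxrank_tr trmx_mul mxrankMfree; last first.
    by rewrite row_free_unit unitmx_tr ctrmx_unit.
  by rewrite mxrank_tr rank_diag_mx; apply: eq_bigr => j _; rewrite !mxE subr_eq0.
have cntE (w : R[i]) : (\sum_j (z 0 j != w)%R + \sum_j (z 0 j == w)%R)%N = n.
  rewrite -big_split /= -[RHS]card_ord -sum1_card; apply: eq_bigr => j _.
  by case: (z 0 j == w).
have psi_ne j : psi j != e.
  have rk : \rank (G - (expi e)%:M) = n by apply: mxrank_unit.
  apply/eqP => psie; have := cntE (expi e); rewrite -rkE rk => /eqP.
  rewrite -[X in _ == X]addn0 eqn_add2l (bigD1 j) //=.
  by have [_ <-] := psiP j; rewrite psie eqxx.
have e2 : forall x, 0 <= x < e -> 0 <= x < 2 * pi.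
  by move=> x; lra.
have -> : arc_count (- G) e = (\sum_j (psi j < e)%R)%N.
  rewrite /arc_count (fsbig_count (r := psi)) => [|x /= xe].
    apply: eq_bigr => j _; congr nat_of_bool.
    have [/andP[j0 _] _] := psiP j.
    by apply/idP/idP => [/set_mem/andP[]//|je]; apply/mem_set => /=; rewrite j0.
  rewrite mxrank_coker expiD_pi raddfN /= opprK addrC -opprB mxrank_opp.
  rewrite rkE -[X in (X - _)%N](cntE (expi x)) addKn; apply: eq_bigr => j _.
  have [psij <-] := psiP j; congr nat_of_bool.
  by apply/eqP/eqP => [|->//]; apply: expi_inj => //; exact: e2.
set H := _ + _.
have -> : H = P^t* *m diag_mx
    (\row_j ((4 * (sin (psi j / 2) * sin ((e - psi j) / 2)))%:C)%C) *m P.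
  rewrite /H -[G^t* - _]/((G^t*) - 1%:M) -[X in _ + q *: (_ - X)]ctrmx1 -ctrmxN -ctrmxD.
  rewrite subE !ctrmxM trmxCK mulmxA.
  have lin (a : R[i]) (K : 'M[R[i]]_n) : a *: (P^t* *m K *m P) = P^t* *m (a *: K) *m P.
    by rewrite -scalemxAr -scalemxAl.
  rewrite !lin -mulmxDl -mulmxDr.
  congr (_ *m _ *m _); apply/matrixP => i k; rewrite !mxE.
  have [ik|ik] := eqVneq i k; last first.
    by rewrite !mulr0n conjC0 !mulr0 addr0.
  rewrite ik !mulr1n -arc_form_expi rmorphB rmorph1.
  by have [_ <-] := psiP k.
rewrite neg_inertia_diag //; last first.
  by move=> j; rewrite mxE; apply/complex_realP; eexists.
rewrite -big_split /= -[RHS]card_ord -sum1_card; apply: eq_bigr => j _.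
rewrite mxE; set t := 4 * _.
have -> : (t%:C%C < 0) = (t < 0) by exact: (ltcR t 0).
rewrite arc_form_lt0 //; last by have [] := psiP j.
by have := psi_ne j; case: ltgtP.
Qed.

(** * Cayley transforms *)

Definition cayley_den (C : numClosedFieldType) n (B : 'M[C]_n) : 'M[C]_n :=
  1%:M - 'i *: B.

Lemma cayley_den_ctr (C : numClosedFieldType) n (B : 'M[C]_n) :
  B^t* = B -> (cayley_den B)^t* = 1%:M + 'i *: B.
Proof.
by move=> hB; rewrite ctrmxD ctrmxN ctrmxZ ctrmx1 hB conjCi scaleNr opprK.
Qed.

(** If [v = i v B], the real number [v v^*] is [i] times the real number [v B v^*], so it
    vanishes. *)
Lemma cayley_den_unit (C : numClosedFieldType) n (B : 'M[C]_n) :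
  B^t* = B -> cayley_den B \in unitmx.
Proof.
move=> hB; rewrite -row_free_unit -kermx_eq0; apply/eqP/row_matrixP => k.
set v := row k _; rewrite row0.
have : v *m cayley_den B = 0 by apply/sub_kermxP; exact: row_sub.
rewrite mulmxBr mulmx1 -scalemxAr => /eqP; rewrite subr_eq0 => /eqP vB.
have vv : herm_form 1%:M v = 'i * herm_form B v.
  by rewrite /herm_form mulmx1 {1}vB -scalemxAl mxE.
have vvE : herm_form 1%:M v = \sum_j `|v 0 j| ^+ 2.
  rewrite -diag_const_mx herm_form_diag; apply: eq_bigr => j _.
  by rewrite mxE mul1r.
have b0 : herm_form B v = 0.
  have bR := herm_form_real v hB.
  have : 'i * herm_form B v \is Num.real.
    by rewrite -vv herm_form_real // ctrmx1.
  rewrite CrealE rmorphM /= conjCi (CrealP bR) mulNr eq_sym -subr_eq0 opprK -mulr2n.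
  by rewrite mulrn_eq0 /= mulf_eq0 (negbTE (neq0Ci C)) => /eqP.
have : \sum_j `|v 0 j| ^+ 2 = 0 by rewrite -vvE vv b0 mulr0.
move=> /psumr_eq0P v0; apply/rowP => j; rewrite [RHS]mxE; apply/eqP.
by have /eqP := v0 (fun j _ => exprn_ge0 2 (normr_ge0 _)) j isT; rewrite expf_eq0 normr_eq0.
Qed.

Lemma ctrmx_inv (C : numClosedFieldType) n (A : 'M[C]_n) :
  (invmx A)^t* = invmx (A^t* ).
Proof. by rewrite trmx_inv map_invmx. Qed.

(** This relation, invertibility, and [J' = J + i D] are what the computations with Cayley quotients
    below rest on; in particular it makes [J] commute with [J^*]. *)
Lemma cayley_den_ctrE (C : numClosedFieldType) n (B : 'M[C]_n) : B^t* = B ->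
  (cayley_den B)^t* = 2%:M - cayley_den B.
Proof.
move=> hB; rewrite cayley_den_ctr // /cayley_den opprB addrCA.
have -> : 2%:M = 1%:M + 1%:M :> 'M[C]_n by rewrite -raddfD.
by rewrite addrK addrC.
Qed.

(* [S *m S'^-1] for the Cayley transforms [S = J^t* *m J^-1] and
   [S' = J'^t* *m J'^-1]. *)
Definition cayley_quotient (C : numClosedFieldType) n (J J' : 'M[C]_n) : 'M[C]_n :=
  J^t* *m invmx J *m J' *m invmx (J'^t* ).

Definition arc_perturb (C : numClosedFieldType) n (q s : C) (J : 'M[C]_n) : 'M[C]_n :=
  - (2 * s)^-1 *: (q^* *: invmx J + q *: invmx (J^t* )).

Section CayleyQuotient.
Variables (C : numClosedFieldType) (n : nat) (J J' D : 'M[C]_n).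
Hypotheses (uJ : J \in unitmx) (uJ' : J' \in unitmx).
Hypotheses (eJ : J^t* = 2%:M - J) (eJ' : J'^t* = 2%:M - J').
Hypotheses (hD : D^t* = D) (eD : J' = J + 'i *: D).
Local Notation G := (cayley_quotient J J').

Let uJs : J^t* \in unitmx. Proof. by rewrite ctrmx_unit. Qed.
Let uJs' : J'^t* \in unitmx. Proof. by rewrite ctrmx_unit. Qed.

Lemma cayley_quotient_unitary : G *m G^t* = 1%:M.
Proof.
have commV (X : 'M[C]_n) : X \in unitmx -> X^t* = 2%:M - X ->
    invmx (X^t* ) *m invmx X = invmx X *m invmx (X^t* ).
  move=> uX eX; have uXs : X^t* \in unitmx by rewrite ctrmx_unit.
  have cX : X^t* *m X = X *m X^t* by rewrite eX mulmxBl mulmxBr scalar_mxC.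
  have V2 : invmx X *m invmx (X^t* ) *m (X^t* *m X) = 1%:M.
    by rewrite mulmxA mulmxKV // mulVmx.
  have <- : invmx X *m invmx (X^t* ) *m (X *m X^t* ) *m (invmx (X^t* ) *m invmx X) =
      invmx (X^t* ) *m invmx X.
    by rewrite -cX V2 mul1mx.
  by rewrite !mulmxA mulmxK // mulmxK.
rewrite /cayley_quotient !ctrmxM !ctrmx_inv !trmxCK !mulmxA.
rewrite -[_ *m invmx (J'^t* ) *m _]mulmxA commV //.
rewrite ![X in X *m J'^t* ]mulmxA mulmxKV // mulmxK //.
rewrite -[_ *m invmx J *m _]mulmxA -commV // mulmxA mulmxV // mul1mx.
by rewrite mulVmx.
Qed.

(** Multiplying by [J'] and [J'^*] cancels the inverse belonging to [J']. Then [J^* = 2 - J] and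
    [J' = J + i D] leave only terms carrying a factor [D]. *)
Lemma cayley_quotient_subl :
  J' *m (G - 1%:M) *m J'^t* = (2 * 'i) *: D - 2 *: (D *m invmx J *m D).
Proof.
rewrite mulmxBr mulmxBl mulmx1 {1}/cayley_quotient !mulmxA mulmxKV //.
have -> : J' *m J^t* *m invmx J *m J' = 2 *: (J' *m invmx J *m J') - J' *m J'.
  rewrite eJ mulmxBr mulmxBl mulmxK // mulmxBl; congr (_ - _).
  by rewrite scalar_mxC -!mulmxA mul_scalar_mx.
have -> : J' *m J'^t* = 2 *: J' - J' *m J'.
  by rewrite eJ' mulmxBr scalar_mxC mul_scalar_mx.
rewrite opprB addrA subrK -scalerBr eD; set K := 'i *: D.
have -> : (J + K) *m invmx J *m (J + K) - (J + K) = K + K *m invmx J *m K.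
  rewrite mulmxDl mulmxV // mulmxDl mul1mx mulmxDr mulmxKV // [X in X = _]addrC.
  by rewrite addKr.
rewrite scalerDr scalerA /K -!scalemxAl -!scalemxAr ['i *: ('i *: _)]scalerA -expr2 sqrCi scaleN1r.
by rewrite scalerN.
Qed.

Variables (q s : C).
Hypotheses (qq : q * q^* = 1) (qs : q - q^* = 2 * 'i * s) (s_gt0 : 0 < s).
Local Notation A := (arc_perturb q s J).

Lemma arc_perturb_ctr : A^t* = A.
Proof.
rewrite /arc_perturb ctrmxZ ctrmxD !ctrmxZ !ctrmx_inv trmxCK conjCK addrC.
by congr (_ *: _); apply: conj_Creal; rewrite rpredN rpredV rpredM // gtr0_real.
Qed.

Lemma cayley_quotient_form :
  J' *m (q^* *: (G - 1%:M) + q *: (G^t* - 1%:M)) *m J'^t* =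
  (4 * s) *: (D + D *m A *m D).
Proof.
rewrite mulmxDr mulmxDl -!scalemxAr -!scalemxAl cayley_quotient_subl.
have -> : J' *m (G^t* - 1%:M) *m J'^t* = (J' *m (G - 1%:M) *m J'^t* )^t*.
  by move: G => X; rewrite !ctrmxM trmxCK ctrmxD ctrmxN ctrmx1 mulmxA.
rewrite cayley_quotient_subl ctrmxD ctrmxN !ctrmxZ !ctrmxM hD ctrmx_inv.
rewrite rmorphM /= conjCi rmorph_nat mulmxA /arc_perturb.
move: (invmx J) (invmx (J^t* )) => R Rs.
rewrite mulmxDr -!scalemxAr mulmxDl -!scalemxAl.
move: (D *m R *m D) (D *m Rs *m D) => X Xs.
rewrite [RHS]scalerDr [in RHS]scalerA mulrN !scalerBr !scalerA addrACA.
rewrite -scalerDl -opprD; congr (_ + _).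
  congr (_ *: _).
  have -> : q^* * (2 * 'i) + q * - (2 * 'i) = - (q - q^* ) * (2 * 'i) by ring.
  rewrite qs; have -> : - (2 * 'i * s) * (2 * 'i) = - (4 * s) * 'i ^+ 2 by ring.
  by rewrite sqrCi mulrN1 opprK.
have -> : 4 * s * - (2 * s)^-1 = - 2 by field; rewrite gt_eqF.
by rewrite scaleNr scalerDr !scalerA ![2 * _]mulrC.
Qed.

Lemma cayley_quotient_inertia :
  neg_inertia (q^* *: (G - 1%:M) + q *: (G^t* - 1%:M)) =
  neg_inertia (D + D *m A *m D).
Proof.
have := cayley_quotient_form; have := arc_perturb_ctr.
move: G A => X Y hY; set H := _ + q *: _ => eH.
have hH : H^t* = H.
  by rewrite /H ctrmxD !ctrmxZ !ctrmxD !ctrmxN ctrmx1 conjCK trmxCK addrC.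
rewrite -(neg_inertia_congr uJ' hH) eH neg_inertiaZ //.
  by rewrite mulr_gt0.
by rewrite ctrmxD !ctrmxM hD hY mulmxA.
Qed.

(** With [k = 1 - q^2], which is nonzero because [s > 0], multiplying [G - q^2] by [J'] on the left
    and by [J'^* J'^-1 J^-*] on the right yields exactly [k (1 + D A)]. *)
Lemma cayley_quotient_unit :
  G - (q ^+ 2)%:M \in unitmx -> 1%:M + D *m A \in unitmx.
Proof.
set k := 1 - q ^+ 2.
have kE : k = - (2 * 'i * s * q).
  by rewrite -qs /k -qq; ring.
have q0 : q != 0 by apply: contra_eq_neq qq => ->; rewrite mul0r eq_sym oner_eq0.
have k0 : k != 0.
  by rewrite kE oppr_eq0 !mulf_neq0 ?neq0Ci ?pnatr_eq0 // gt_eqF.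
have eDs : J'^t* = J^t* - 'i *: D.
  by rewrite eD ctrmxD ctrmxZ hD conjCi scaleNr.
have RRs : 2 *: (invmx J *m invmx (J^t* )) = invmx J + invmx (J^t* ).
  have <- : invmx J *m (J + J^t* ) *m invmx (J^t* ) = invmx J + invmx (J^t* ).
    by rewrite mulmxDr mulmxDl mulVmx // mul1mx mulmxK // addrC.
  have -> : J + J^t* = 2%:M by rewrite eJ addrC subrK.
  by rewrite scalar_mxC -mulmxA mul_scalar_mx.
have cJ' : J' *m J'^t* = J'^t* *m J' by rewrite eJ' mulmxBl mulmxBr scalar_mxC.
have -> : G - (q ^+ 2)%:M = (G - 1%:M) + k%:M.
  by rewrite /k raddfB /= addrA subrK.
set X := _ + _ => uX.
have : J' *m X *m J'^t* *m invmx J' *m invmx (J^t* ) \in unitmx.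
  by rewrite !unitmx_mul uJ' uX uJs' !unitmx_inv uJ' uJs.
rewrite /X mulmxDr !mulmxDl cayley_quotient_subl.
have -> : (2 * 'i) *: D - 2 *: (D *m invmx J *m D) = (2 * 'i) *: (D *m invmx J *m J').
  rewrite eD mulmxDr mulmxKV // scalerDr; congr (_ + _).
  rewrite -scalemxAr scalerA -mulrA -expr2 sqrCi.
  by rewrite mulrN1 scaleNr.
rewrite scalar_mxC mul_scalar_mx -!scalemxAl cJ' !mulmxK // eDs.
rewrite mulmxBl mulmxV // -scalemxAl -mulmxA [2 * 'i]mulrC -scalerA.
rewrite scalemxAr RRs /arc_perturb.
move: (invmx J) (invmx (J^t* )) => R Rs.
suff -> : 'i *: (D *m (R + Rs)) + k *: (1%:M - 'i *: (D *m Rs)) =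
    k *: (1%:M + D *m (- (2 * s)^-1 *: (q^* *: R + q *: Rs))).
  by rewrite unitmxZ // unitfE.
rewrite [RHS]scalerDr -scalemxAr scalerA [k *: (1%:M - _)]scalerBr.
rewrite addrCA; congr (_ + _).
rewrite !mulmxDr -!scalemxAr.
move: (D *m R) (D *m Rs) => Y Ys.
have ks : k * - (2 * s)^-1 = 'i * q by rewrite kE; field; rewrite gt_eqF.
rewrite !scalerDr !scalerA ks -addrA; congr (_ + _).
  by rewrite -mulrA qq mulr1.
by rewrite -scalerBl; congr (_ *: _); rewrite /k; ring.
Qed.

Let Q : 'M[C]_(n + n) := block_mx D 1%:M 1%:M (- A).

Lemma cayley_graph_ctr : Q^t* = Q.
Proof. by rewrite ctrmx_block ctrmxN ctrmx1 hD arc_perturb_ctr. Qed.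

Lemma cayley_graph_unit : G - (q ^+ 2)%:M \in unitmx -> Q \in unitmx.
Proof.
move=> /cayley_quotient_unit; rewrite /Q; move: A => X uF.
have : block_mx D 1%:M 1%:M (- X) *m block_mx X 1%:M 1%:M 0 \in unitmx.
  rewrite mulmx_block !(mul1mx, mulmx1, mulmx0, addr0) subrr.
  by rewrite unitmxE det_ublock det1 mulr1 -unitmxE addrC.
by rewrite unitmx_mul => /andP[].
Qed.

Lemma cayley_graph_inertia : G - (q ^+ 2)%:M \in unitmx ->
  (neg_inertia (q^* *: (G - 1%:M) + q *: (G^t* - 1%:M)) + neg_inertia Q =
   neg_inertia D + n)%N.
Proof.
move=> /cayley_quotient_unit uF; rewrite cayley_quotient_inertia.
exact: neg_inertia_graph hD arc_perturb_ctr uF.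
Qed.

End CayleyQuotient.

(* Nonsingular even where [B - B'], which measures the intersection of the two
   planes, is singular. *)
Definition graph_mx (R : realType) n (e : R) (B B' : 'M[R[i]]_n) : 'M[R[i]]_(n + n) :=
  block_mx (B - B') 1%:M 1%:M
    (- arc_perturb (expi (e / 2)) ((sin (e / 2))%:C)%C (cayley_den B)).

(** The inertia of the arc form is eliminated between [arc_count_inertia] and
    [cayley_graph_inertia]; the summand [n] cancels. The half angle in [q] makes [q^2] the endpoint
    of the arc. *)
Lemma arc_count_cayley (R : realType) n (e : R) (B B' : 'M[R[i]]_n)
    (G := cayley_quotient (cayley_den B) (cayley_den B')) :
  0 < e < pi -> B^t* = B -> B'^t* = B' -> G - (expi e)%:M \in unitmx ->
  [/\ (arc_count (- G) e + neg_inertia (B - B') = neg_inertia (graph_mx e B B'))%N,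
      (graph_mx e B B')^t* = graph_mx e B B' & graph_mx e B B' \in unitmx].
Proof.
move=> epi hB hB' Gu; rewrite /graph_mx.
set q := expi (e / 2); set s := ((sin (e / 2))%:C)%C; set D := B - B'.
have hD : D^t* = D by rewrite ctrmxD ctrmxN hB hB'.
have qq : q * q^* = 1 by rewrite conj_expi -expiD subrr expi0.
have q2 : q ^+ 2 = expi e by rewrite expr2 -expiD -splitr.
have qs : q - q^* = 2 * 'i * s.
  rewrite conj_expi /q /s /expi cosN sinN; apply/eqP; rewrite eq_complex /=.
  by apply/andP; split; apply/eqP; ring.
have s0 : 0 < s.
  have s0 : 0 < sin (e / 2).
    by apply: sin_gt0_pi; case/andP: epi => ? ?; apply/andP; split; lra.
  by rewrite /s (ltcR 0).
have eD : cayley_den B' = cayley_den B + 'i *: D.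
  by rewrite /cayley_den /D scalerBr addrA subrK.
have uJ := cayley_den_unit hB; have uJ' := cayley_den_unit hB'.
have eJ := cayley_den_ctrE hB; have eJ' := cayley_den_ctrE hB'.
have GG := cayley_quotient_unitary uJ uJ' eJ eJ'.
rewrite -q2 in Gu; split.
- have := arc_count_inertia epi GG; rewrite -q2 -/q => /(_ Gu).
  have := cayley_graph_inertia uJ uJ' eJ eJ' hD eD qq qs s0 Gu.
  move: (neg_inertia _) (neg_inertia _) (neg_inertia _) (arc_count _ _) => h Q d r e1 e2.
  by lia.
- exact: (cayley_graph_ctr _ hD _ s0).
- exact: (cayley_graph_unit uJ uJ' eJ eJ' hD eD qq qs s0 Gu).
Qed.

(** * The comparative index in a chart *)

(** Identifies the ingredients of the comparative index with the data of [neg_inertia_schur_pinv]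
    for the matrix [[[A, B], [B^T, D]]]. Since [A] is [- Xh^T] times an invertible matrix, the
    projection [Xh^+ Xh] in the index is the projection [A A^+] of the elimination. *)
Lemma comp_index_schur (R : realType) n (N Nh X' Xh' : 'M[R]_n) (Y Yh : 'M[R]_(n + n, n))
    (A : 'M[R]_n := - (Xh'^T *m usubmx Yh)) (B := Xh'^T *m usubmx Y)
    (D : 'M[R]_n := - (X'^T *m usubmx Y))
    (M := comp_index_M Yh Y) (V : 'M[R]_n := 1%:M - mp_pinv M *m M) :
  N^T = N -> Nh^T = Nh -> X' \in unitmx -> Xh' \in unitmx ->
  usubmx Y = N *m X' -> usubmx Yh = Nh *m Xh' ->
  wronskian Yh Y = Xh'^T *m (N - Nh) *m X' ->
  [/\ A^T = A, M = (1%:M - A *m mp_pinv A) *m B &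
      comp_index_P Yh Y = V *m (D - B^T *m mp_pinv A *m B) *m V].
Proof.
move=> hN hNh uX uXh eX eXh eW.
have hA : A^T = A.
  by rewrite /A linearN /= eXh !trmx_mul trmxK hNh !mulmxA.
have eXhT : (usubmx Yh)^T = Xh'^T *m Nh by rewrite eXh trmx_mul hNh.
have AE : A = - ((usubmx Yh)^T *m Xh') by rewrite /A eXhT eXh mulmxA.
have eW' : wronskian Yh Y = B - (usubmx Yh)^T *m X'.
  by rewrite eW eXhT /B eX mulmxBr mulmxBl mulmxA.
have [PX1 PX2 PX3 PX4] := mp_pinvP (usubmx Yh).
have [PA1 PA2 PA3 PA4] := mp_pinvP A.
have [PM1 PM2 PM3 PM4] := mp_pinvP M.
have eM : M = (1%:M - mp_pinv (usubmx Yh) *m usubmx Yh) *m wronskian Yh Y by [].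
have eP : comp_index_P Yh Y = V *m (wronskian Yh Y)^T *m mp_pinv (usubmx Yh) *m usubmx Y *m V by [].
move: eP eM; set Pi := mp_pinv (usubmx Yh) *m usubmx Yh => eP eM.
have PiT : Pi^T = Pi by [].
have PiXT : Pi *m (usubmx Yh)^T = (usubmx Yh)^T.
  by rewrite -{1}PiT -trmx_mul mulmxA PX1.
have PiA : Pi *m A = A by rewrite AE mulmxN mulmxA PiXT.
have APi : A *m Pi = A by rewrite -{1}hA -{1}PiT -trmx_mul PiA hA.
have XhT : (usubmx Yh)^T = - (A *m invmx Xh').
  by rewrite AE mulNmx opprK mulmxK.
have AAXhT : A *m mp_pinv A *m (usubmx Yh)^T = (usubmx Yh)^T.
  by rewrite XhT mulmxN mulmxA PA1.
(* Both are symmetric projections, and each fixes the range of the other. *)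
have AAPi : A *m mp_pinv A = Pi.
  have e1 : A *m mp_pinv A *m Pi = Pi.
    by rewrite -[Pi in LHS]PiT -[RHS]PiT /Pi trmx_mul mulmxA AAXhT.
  have e2 : Pi *m (A *m mp_pinv A) = A *m mp_pinv A by rewrite mulmxA PiA.
  by rewrite -e2 -{1}PiT -PA3 -trmx_mul e1 PiT.
have eM' : M = (1%:M - A *m mp_pinv A) *m B.
  rewrite eM AAPi eW' mulmxBr -[RHS]subr0; congr (_ - _).
  by rewrite mulmxA mulmxBl mul1mx PiXT subrr mul0mx.
split=> //.
have hV : V^T = V by rewrite /V linearB /= trmx1 PM4.
have MV : M *m V = 0 by rewrite /V mulmxBr mulmx1 mulmxA PM1 subrr.
have eA : A = - (Xh'^T *m usubmx Yh) by [].
have eB : B = Xh'^T *m usubmx Y by [].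
have eD : D = - (X'^T *m usubmx Y) by [].
have [G eG] : {G | G = mp_pinv A *m B *m V} by eexists.
clear PiXT PiT PiA AAXhT AAPi PA1 PA2 PA3 PA4 PM1 PM2 PM3 PM4 PX1 PX2 PX3 PX4 AE eM.
move: eP hV MV eA eB eD eG eM' eW' hA XhT APi eXhT eX eXh eW.
rewrite /Pi; clear Pi; move: (comp_index_P _ _) (wronskian _ _) M V A B D.
move: (usubmx Yh) (usubmx Y).
move=> Xh X P W M V A B D eP hV MV eA eB eD eG eM' eW' hA XhT APi _ _ _ _.
(* [M V = 0] places [B V] in the range of [A]. Hence [W V] and [X V] are both expressible through
   [G], and the two formulas for the compressed matrix can be compared. *)
have BV : B *m V = A *m G.
  have : (1%:M - A *m mp_pinv A) *m B *m V = 0 by rewrite -eM'.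
  by rewrite !mulmxBl mul1mx eG !mulmxA => /subr0_eq.
have WV : W *m V = A *m (G + invmx Xh' *m (X' *m V)).
  by rewrite eW' mulmxBl BV XhT mulmxDr !mulNmx opprK !mulmxA.
have uXhT : Xh'^T \in unitmx by rewrite unitmx_tr.
have XV : X *m V = - (Xh *m G).
  apply: (can_inj (mulKmx uXhT)); rewrite mulmxA -eB BV eA.
  by rewrite mulNmx mulmxN mulmxA.
have VBBV : V *m (B^T *m mp_pinv A *m B) *m V = G^T *m A *m G.
  have -> : V *m (B^T *m mp_pinv A *m B) *m V = (B *m V)^T *m (mp_pinv A *m B *m V).
    by rewrite trmx_mul hV !mulmxA.
  by rewrite BV -eG trmx_mul hA.
have PE : P = (W *m V)^T *m mp_pinv Xh *m (X *m V) by rewrite eP trmx_mul hV !mulmxA.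
have VDV : V *m D *m V = (X' *m V)^T *m (Xh *m G).
  by rewrite eD mulmxN mulNmx trmx_mul hV -[Xh *m G]opprK -XV mulmxN !mulmxA.
rewrite mulmxBr mulmxBl VBBV VDV PE WV XV trmx_mul hA mulmxN.
have -> : (G + invmx Xh' *m (X' *m V))^T *m A *m mp_pinv Xh *m (Xh *m G) =
    (G + invmx Xh' *m (X' *m V))^T *m (A *m (mp_pinv Xh *m Xh)) *m G.
  by rewrite !mulmxA.
rewrite APi linearD /= !mulmxDl opprD addrC; congr (_ - _).
rewrite trmx_mul trmx_inv eA mulmxN mulNmx opprK -!mulmxA.
by congr (_ *m _); rewrite mulmxA mulVmx // mul1mx.
Qed.

Lemma mp_pinv_sym (R : realType) n (A : 'M[R]_n) : A^T = A -> (mp_pinv A)^T = mp_pinv A.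
Proof.
move=> hA; have [A1 A2 A3 A4] := mp_pinvP A.
apply: (penrose_uniq (A := A)) => //; split.
- by rewrite -[RHS]hA -[in RHS]A1 !trmx_mul hA mulmxA.
- by rewrite -[in RHS]A2 !trmx_mul hA mulmxA.
- by rewrite trmx_mul trmxK hA -[LHS]A4 trmx_mul hA.
- by rewrite trmx_mul trmxK hA -[LHS]A3 trmx_mul hA.
Qed.

Lemma comp_index_inertia (R : realType) n (N Nh X' Xh' : 'M[R]_n)
    (Y Yh : 'M[R]_(n + n, n)) :
  N^T = N -> Nh^T = Nh -> X' \in unitmx -> Xh' \in unitmx ->
  usubmx Y = N *m X' -> usubmx Yh = Nh *m Xh' ->
  wronskian Yh Y = Xh'^T *m (N - Nh) *m X' ->
  (comp_index Yh Y + neg_inertia (cmx (- Nh)) =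
   neg_inertia (cmx (N - Nh)) + neg_inertia (cmx (- N)))%N.
Proof.
move=> hN hNh uX uXh eX eXh eW.
have [] := comp_index_schur hN hNh uX uXh eX eXh eW.
set M := comp_index_M Yh Y; set A := - (Xh'^T *m _); set B := Xh'^T *m _.
set D := - (X'^T *m _) => hA eM eP.
have eA : A = Xh'^T *m (- Nh) *m Xh' by rewrite /A eXh mulmxN mulNmx mulmxA.
have eB : B = Xh'^T *m N *m X' by rewrite /B eX mulmxA.
have eD : D = X'^T *m (- N) *m X' by rewrite /D eX mulmxN mulNmx mulmxA.
have eM0 : comp_index_M Yh Y = M by [].
clearbody A B D M.
have hD : D^T = D by rewrite eD !trmx_mul trmxK linearN /= hN mulmxA.
have hB : B^T = X'^T *m N *m Xh' by rewrite eB !trmx_mul trmxK hN mulmxA.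
have hA' := mp_pinv_sym hA.
have [A1 A2 A3 A4] := mp_pinvP A; have [M1 M2 M3 M4] := mp_pinvP M.
have hP : (comp_index_P Yh Y)^T = comp_index_P Yh Y.
  have hV : (1%:M - mp_pinv M *m M)^T = 1%:M - mp_pinv M *m M.
    by rewrite linearB /= trmx1 M4.
  rewrite eP; move: (1%:M - _ *m M) hV => V hV.
  by rewrite !trmx_mul hV linearB /= !trmx_mul trmxK hA' hD !mulmxA.
have sym m k (K : 'M[R]_(m, k)) : (cmx K)^t* = cmx K^T by exact: ctrmx_real.
(* Elimination from the corner [A], congruent to [- Nh], gives the comparative index; elimination of
   the same matrix from the opposite corner, in [neg_inertia_difference], gives the right-hand
   side. *)
have := @neg_inertia_schur_pinv _ n (cmx A) (cmx (mp_pinv A)) (cmx B)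
  (cmx D) (cmx M) (cmx (mp_pinv M)).
rewrite !sym hA hA' hD -!map_mxM !sym /= A1 A2 A3 M1 M2 M3 M4.
rewrite -[1%:M](map_mx1 (real_complex R)) -!map_mxB -!map_mxM.
rewrite -eP -eM => /(_ erefl erefl erefl erefl erefl erefl erefl erefl erefl erefl erefl).
rewrite /comp_index eM0 neg_index_inertia // mxrank_map.
have -> : neg_inertia (cmx A) = neg_inertia (cmx (- Nh)).
  rewrite eA !map_mxM -[cmx Xh']trmxCK sym neg_inertia_congr // ?sym ?linearN /= ?hNh //.
  by rewrite map_unitmx unitmx_tr.
have -> : neg_inertia (block_mx (cmx A) (cmx B) (cmx B^T) (cmx D)) =
    (neg_inertia (cmx (N - Nh)) + neg_inertia (cmx (- N)))%N.
  have := @neg_inertia_difference _ n (cmx N) (cmx Nh) (cmx X') (cmx Xh').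
  rewrite !map_unitmx !sym hN hNh uX uXh => /(_ erefl erefl isT isT).
  by rewrite hB eA eB eD !map_mxM !map_mxN map_mxD map_mxN.
by move=> ->; rewrite addnC addnA.
Qed.

(** * Continuity *)

(** Entrywise, so that limits of products, determinants and inverses reduce to scalar sums and
    products. *)
Definition mx_cvg (K : numFieldType) T (F : set_system T) m n
    (f : T -> 'M[K]_(m, n)) (l : 'M[K]_(m, n)) :=
  forall i j, (f s i j @[s --> F] --> l i j)%classic.

Section MxCvg.
Context (K : numFieldType) (T : Type) (F : set_system T) (FF : Filter F).

Lemma mx_cvg_cst m n (A : 'M[K]_(m, n)) : mx_cvg F (fun=> A) A.
Proof. by move=> i j; exact: cvg_cst. Qed.

Lemma mx_cvgD m n (f g : T -> 'M[K]_(m, n)) A B :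
  mx_cvg F f A -> mx_cvg F g B -> mx_cvg F (fun s => f s + g s) (A + B).
Proof.
by move=> fA gB i j; rewrite mxE; under eq_fun do rewrite mxE; exact: cvgD.
Qed.

Lemma mx_cvgN m n (f : T -> 'M[K]_(m, n)) A :
  mx_cvg F f A -> mx_cvg F (fun s => - f s) (- A).
Proof.
by move=> fA i j; rewrite mxE; under eq_fun do rewrite mxE; exact: cvgN.
Qed.

Lemma mx_cvgZ m n (c : K) (f : T -> 'M[K]_(m, n)) A :
  mx_cvg F f A -> mx_cvg F (fun s => c *: f s) (c *: A).
Proof.
move=> fA i j; rewrite mxE; under eq_fun do rewrite mxE.
by apply: cvgM => //; exact: cvg_cst.
Qed.

Lemma mx_cvgM m n p (f : T -> 'M[K]_(m, n)) (g : T -> 'M[K]_(n, p)) A B :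
  mx_cvg F f A -> mx_cvg F g B -> mx_cvg F (fun s => f s *m g s) (A *m B).
Proof.
move=> fA gB i j; rewrite mxE; under eq_fun do rewrite mxE.
apply: cvg_big => [|k _]; first exact: add_continuous.
exact: cvgM.
Qed.

Lemma mx_cvg_block m1 m2 n1 n2 (f1 : T -> 'M[K]_(m1, n1)) (f2 : T -> 'M[K]_(m1, n2))
    (f3 : T -> 'M[K]_(m2, n1)) (f4 : T -> 'M[K]_(m2, n2)) A1 A2 A3 A4 :
  mx_cvg F f1 A1 -> mx_cvg F f2 A2 -> mx_cvg F f3 A3 -> mx_cvg F f4 A4 ->
  mx_cvg F (fun s => block_mx (f1 s) (f2 s) (f3 s) (f4 s)) (block_mx A1 A2 A3 A4).
Proof.
move=> h1 h2 h3 h4 i j.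
case: (split_ordP i) => i' ->; case: (split_ordP j) => j' ->.
- by rewrite block_mxEul; under eq_fun do rewrite block_mxEul; exact: h1.
- by rewrite block_mxEur; under eq_fun do rewrite block_mxEur; exact: h2.
- by rewrite block_mxEdl; under eq_fun do rewrite block_mxEdl; exact: h3.
- by rewrite block_mxEdr; under eq_fun do rewrite block_mxEdr; exact: h4.
Qed.

Lemma cvg_det n (f : T -> 'M[K]_n) A :
  mx_cvg F f A -> (\det (f s) @[s --> F] --> \det A)%classic.
Proof.
move=> fA; apply: cvg_big => [|p _]; first exact: add_continuous.
apply: cvgM; first exact: cvg_cst.
by apply: cvg_big => [|k _]; [exact: mul_continuous | exact: fA].
Qed.

Lemma near_unitmx n (f : T -> 'M[K]_n) A :
  mx_cvg F f A -> A \in unitmx -> \forall s \near F, f s \in unitmx.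
Proof.
move=> /cvg_det fA; rewrite unitmxE unitfE => A0.
have : \forall s \near F, \det (f s) != 0 by exact: (@cvgr_neq0 K K^o _ _ FF _ _ fA).
by apply: filterS => s; rewrite unitmxE unitfE.
Qed.

Lemma mx_cvg_inv n (f : T -> 'M[K]_n) A :
  mx_cvg F f A -> A \in unitmx -> mx_cvg F (fun s => invmx (f s)) (invmx A).
Proof.
move=> fA uA i j.
have fu := near_unitmx fA uA.
have fV : ((\det (f s))^-1 * \adj (f s) i j @[s --> F] --> (invmx A) i j)%classic.
  rewrite /invmx uA mxE; apply: cvgM.
    by apply: cvgV; [rewrite -unitfE -unitmxE | exact: cvg_det].
  rewrite mxE; under eq_fun do rewrite mxE.
  apply: cvgM; first exact: cvg_cst.
  apply: cvg_det => k l; rewrite !mxE; under eq_fun do rewrite !mxE.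
  exact: fA.
(* [invmx] is given by the adjugate only at invertible matrices, so the formula is available near
   the limit and not everywhere. *)
apply: cvg_trans fV; apply: near_eq_cvg; apply: filterS fu => s us.
by rewrite /invmx us [RHS]mxE.
Qed.

End MxCvg.

Lemma mx_cvg_real (R : realType) T (F : set_system T) (FF : Filter F) m n
    (f : T -> 'M[R]_(m, n)) A :
  mx_cvg F f A ->
  mx_cvg F (fun s => map_mx (real_complex R) (f s)) (map_mx (real_complex R) A).
Proof.
move=> fA i j; rewrite mxE; under eq_fun do rewrite mxE.
apply/cvgrPdist_lt => e e0.
have eE : e = ((complex.Re e)%:C)%C by rewrite RRe_real // gtr0_real.
have Re0 : 0 < complex.Re e by have := e0; rewrite eE (ltcR 0).
have /cvgrPdist_lt/(_ _ Re0) := fA i j; apply: filterS => s.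
rewrite -raddfB normc_def /= expr0n addr0 sqrtr_sqr => h.
by rewrite eE ltcR.
Qed.

(** Semicontinuity bounds the inertias of [H s] and [- H s] from below. By invertibility both pairs
    of inertias add up to [n], which leaves no room for an increase. *)
Lemma near_neg_inertia (C : numClosedFieldType) T (F : set_system T)
    (FF : Filter F) n (H : T -> 'M[C]_n) H0 :
  mx_cvg F H H0 -> H0^t* = H0 -> (\forall s \near F, (H s)^t* = H s) ->
  H0 \in unitmx -> \forall s \near F, neg_inertia (H s) = neg_inertia H0.
Proof.
move=> HH0 hH0 hH uH0.
have uH := near_unitmx FF HH0 uH0.
have low (K : T -> 'M[C]_n) K0 : mx_cvg F K K0 -> K0^t* = K0 ->
    (\forall s \near F, (K s)^t* = K s) ->
    \forall s \near F, (neg_inertia K0 <= neg_inertia (K s))%N.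
  move=> KK0 hK0 hK; have [c c0 Kc] := neg_inertia_open hK0.
  have near_le i j : \forall s \near F, `|K s i j - K0 i j| <= c.
    have /cvgrPdist_le/(_ _ c0) := KK0 i j.
    by apply: filterS => s; rewrite distrC.
  have near_all : \forall s \near F, forall i j, `|K s i j - K0 i j| <= c.
    by apply: filter_forall => i; apply: filter_forall => j.
  by apply: filterS2 hK near_all => s; exact: Kc.
have l1 := low _ _ HH0 hH0 hH.
have l2 : \forall s \near F, (neg_inertia (- H0) <= neg_inertia (- H s))%N.
  apply: low; first exact: mx_cvgN; first by rewrite ctrmxN hH0.
  by apply: filterS hH => s hs; rewrite ctrmxN hs.
near=> s.
have hs : (H s)^t* = H s by near: s.
have us : H s \in unitmx by near: s.
have s1 : (neg_inertia H0 <= neg_inertia (H s))%N by near: s.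
have s2 : (neg_inertia (- H0) <= neg_inertia (- H s))%N by near: s.
have := neg_inertiaN hs; have := neg_inertiaN hH0.
rewrite !mxrank_unit // => h0 hs'.
by apply/eqP; rewrite eqn_leq s1 andbT -(leq_add2r (neg_inertia (- H s))) hs'
  -[X in (X <= _)%N]h0 leq_add2l.
Unshelve. all: by end_near.
Qed.

(** The points of [[a, b]] where [P] holds form a nonempty relatively open and closed subset of a
    connected set. A predicate in place of a function lets the lemma serve both the final identity
    and the construction of partitions. *)
Lemma locally_constant (R : realType) (a b : R) (P : R -> Prop) :
  (forall s0, s0 \in `[a, b] ->
     \forall s \near within [set` `[a, b]] (nbhs s0), P s <-> P s0) ->
  a <= b -> P a -> P b.
Proof.
move=> Ploc ab Pa.
have aab : a \in `[a, b] by rewrite in_itv /= lexx.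
have bab : b \in `[a, b] by rewrite in_itv /= lexx ab.
have := @segment_connected R a b ([set` `[a, b]] `&` [set s | P s]).
suff + : [set` `[a, b]] `&` [set s | P s] = [set` `[a, b]] -> P b.
  move=> eqP conn; apply: eqP; apply: conn.
  - by exists a.
  - exists (interior [set s | s \in `[a, b] -> P s]); first exact: open_interior.
    apply/seteqP; split=> [s [sab Ps]|s [sab /interior_subset]]; last first.
      by move=> /(_ sab).
    split => //; rewrite /interior /=; have := Ploc s sab; rewrite near_withinE.
    by apply: filterS => u h uab; apply/h.
  exists (~` interior [set s | s \in `[a, b] -> ~ P s]).
    by rewrite closedC; exact: open_interior.
  apply/seteqP; split=> [s [sab Ps]|s [sab nPs]].
    by split => // /interior_subset/(_ sab).
  split => //=; apply: contrapT => nP; apply: nPs.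
  rewrite /interior /=; have := Ploc s sab; rewrite near_withinE.
  by apply: filterS => u h uab /(h uab).
by move=> /seteqP[_ /(_ b)[]].
Qed.

(** * Charts of Lagrangian planes *)

(* A rotation sends the blocks [(X, U)] to multiples of [(tau X - U, X + tau U)].
   Where the first one, [chart_den], is invertible, the rotated plane is the graph
   of [(1 + tau ^+ 2) N - tau], with [N] the matrix [chart]. *)
Definition chart_den (R : realType) n (tau : R) (Y : 'M[R]_(n + n, n)) : 'M[R]_n :=
  tau *: usubmx Y - dsubmx Y.

Definition chart (R : realType) n (tau : R) (Y : 'M[R]_(n + n, n)) : 'M[R]_n :=
  usubmx Y *m invmx (chart_den tau Y).

Lemma wronskianE (R : realType) n (Y Yh : 'M[R]_(n + n, n)) :
  wronskian Y Yh = (usubmx Y)^T *m dsubmx Yh - (dsubmx Y)^T *m usubmx Yh.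
Proof.
rewrite /wronskian -{1}[Y]vsubmxK -{1}[Yh]vsubmxK tr_col_mx -mulmxA.
rewrite /symplectic_mx mul_block_col !mul0mx mulNmx !mul1mx add0r addr0.
by rewrite mul_row_col mulmxN.
Qed.

Lemma isotropic_sym (R : realType) n (Y : 'M[R]_(n + n, n)) :
  wronskian Y Y = 0 -> (usubmx Y)^T *m dsubmx Y = (dsubmx Y)^T *m usubmx Y.
Proof. by rewrite wronskianE => /subr0_eq. Qed.

Section Chart.
Variables (R : realType) (n : nat) (tau : R).
Implicit Types Y : 'M[R]_(n + n, n).

Lemma dsubmx_chart Y : dsubmx Y = tau *: usubmx Y - chart_den tau Y.
Proof. by rewrite /chart_den opprB addrC subrK. Qed.

Lemma usubmx_chart Y : chart_den tau Y \in unitmx ->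
  usubmx Y = chart tau Y *m chart_den tau Y.
Proof. by move=> uY; rewrite /chart mulmxKV. Qed.

Lemma chart_sym Y : wronskian Y Y = 0 -> chart_den tau Y \in unitmx ->
  (chart tau Y)^T = chart tau Y.
Proof.
move=> /isotropic_sym symY uY; set Z := chart_den tau Y in uY *.
have uZT : Z^T \in unitmx by rewrite unitmx_tr.
have e : Z^T *m usubmx Y = (usubmx Y)^T *m Z.
  rewrite /Z /chart_den linearB linearZ /= mulmxBl mulmxBr -scalemxAl -scalemxAr.
  by rewrite symY.
rewrite /chart -/Z trmx_mul trmx_inv.
apply: (can_inj (mulKmx uZT)); rewrite mulKVmx // mulmxA e.
by rewrite mulmxK.
Qed.

Lemma wronskian_chart Y Yh : wronskian Y Y = 0 -> wronskian Yh Yh = 0 ->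
  chart_den tau Y \in unitmx -> chart_den tau Yh \in unitmx ->
  wronskian Yh Y =
  (chart_den tau Yh)^T *m (chart tau Y - chart tau Yh) *m chart_den tau Y.
Proof.
move=> isoY isoYh uY uYh; have symYh := chart_sym isoYh uYh.
rewrite wronskianE !dsubmx_chart.
have -> : (tau *: usubmx Yh - chart_den tau Yh)^T =
    tau *: (usubmx Yh)^T - (chart_den tau Yh)^T by rewrite linearB linearZ.
rewrite mulmxBr mulmxBl -scalemxAr -scalemxAl opprB addrC addrA subrK.
rewrite [_ *m (chart _ _ - _)]mulmxBr [RHS]mulmxBl.
by rewrite (usubmx_chart uY) (usubmx_chart uYh) trmx_mul symYh !mulmxA.
Qed.

Lemma comp_index_chart Y Yh : wronskian Y Y = 0 -> wronskian Yh Yh = 0 ->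
  chart_den tau Y \in unitmx -> chart_den tau Yh \in unitmx ->
  (comp_index Yh Y + neg_inertia (cmx (- chart tau Yh)) =
   neg_inertia (cmx (chart tau Y - chart tau Yh)) +
   neg_inertia (cmx (- chart tau Y)))%N.
Proof.
move=> isoY isoYh uY uYh.
apply: (comp_index_inertia (chart_sym isoY uY) (chart_sym isoYh uYh) uY uYh).
- exact: usubmx_chart.
- exact: usubmx_chart.
- exact: wronskian_chart.
Qed.

Lemma chart_den_vert : chart_den tau (vert_plane : 'M[R]_(n + n, n)) = - 1%:M.
Proof. by rewrite /chart_den col_mxKu col_mxKd scaler0 sub0r. Qed.

Lemma chart_vert : chart tau (vert_plane : 'M[R]_(n + n, n)) = 0.
Proof. by rewrite /chart col_mxKu mul0mx. Qed.

Lemma chart_den_vert_unit : chart_den tau (vert_plane : 'M[R]_(n + n, n)) \in unitmx.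
Proof. by rewrite chart_den_vert unitmxE -scaleN1r detZ det1 mulr1 unitrX // unitrN unitr1. Qed.

Lemma vert_isotropic : wronskian (vert_plane : 'M[R]_(n + n, n)) vert_plane = 0.
Proof. by rewrite wronskianE col_mxKu trmx0 mul0mx mulmx0 subrr. Qed.

End Chart.

Lemma exists_nonroot (K : idomainType) (p : {poly K}) (f : nat -> K) :
  p != 0 -> injective f -> exists k : nat, ~~ root p (f k).
Proof.
move=> p0 fI; apply: contrapT => h.
pose rs := [seq f k | k <- iota 0 (size p)].
have rs_uniq : uniq rs by rewrite map_inj_uniq ?iota_uniq.
have rs_root : all (root p) rs.
  by apply/allP => x /mapP[k _ ->]; apply: contrapT => nr; apply: h; exists k; apply/negP.
by have := max_poly_roots p0 rs_root rs_uniq; rewrite size_map size_iota ltnn.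
Qed.

Lemma mulmx_conj_pair (K : comNzRingType) n (i : K) (X U : 'M[K]_n) :
  i ^+ 2 = -1 -> X^T *m U = U^T *m X ->
  (X^T + i *: U^T) *m (X - i *: U) = X^T *m X + U^T *m U.
Proof.
move=> i2 XU; rewrite mulmxDl !mulmxBr -!scalemxAr -!scalemxAl scalerA -expr2 i2.
by rewrite scaleN1r opprK XU addrA subrK.
Qed.

(** By isotropy [(X^T + i U^T) (X - i U)] is the Gram matrix [Y^T Y], which is invertible because
    [Y] has rank [n]. *)
Lemma cminus_unit (R : realType) n (Y : 'M[R]_(n + n, n)) :
  lagrangian_plane Y -> cminus Y \in unitmx.
Proof.
move=> [/isotropic_sym symY rY].
have : Y^T *m Y \in unitmx.
  by rewrite -{2}[Y]trmxK; apply: gram_unit; rewrite /row_free mxrank_tr rY.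
have -> : Y^T *m Y = (usubmx Y)^T *m usubmx Y + (dsubmx Y)^T *m dsubmx Y.
  by rewrite -{1 2}[Y]vsubmxK tr_col_mx mul_row_col.
rewrite -(map_unitmx (real_complex R)) map_mxD !map_mxM -!map_trmx.
rewrite -(mulmx_conj_pair (sqr_i R)) ?unitmx_mul; first by case/andP.
by rewrite map_trmx -map_mxM symY map_mxM map_trmx.
Qed.

Lemma cplus_unit (R : realType) n (Y : 'M[R]_(n + n, n)) :
  lagrangian_plane Y -> cplus Y \in unitmx.
Proof.
move=> /cminus_unit; rewrite -(ctrmx_unit (cminus Y)) -unitmx_tr.
congr (_ \in unitmx); apply/matrixP => i j; rewrite !mxE rmorphB rmorphM /=.
rewrite !conj_real_complex; have -> : ('i%C : R[i])^* = - 'i%C.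
  by apply/eqP; rewrite eq_complex /= oppr0 !eqxx.
by rewrite mulNr opprK.
Qed.

Definition det_pencil (R : realType) n (Y : 'M[R]_(n + n, n)) : {poly R} :=
  \det ('X *: map_mx polyC (usubmx Y) - map_mx polyC (dsubmx Y)).

(** At [i] the pencil [tau X - U] takes the value [i (X + i U)], which is invertible for a
    Lagrangian plane. *)
Lemma det_pencil_neq0 (R : realType) n (Y : 'M[R]_(n + n, n)) :
  lagrangian_plane Y -> det_pencil Y != 0.
Proof.
move=> /cplus_unit uY.
have : (map_poly (real_complex R) (det_pencil Y)).['i%C] != 0.
  have -> : (map_poly (real_complex R) (det_pencil Y)).['i%C] = \det ('i%C *: cplus Y).
    rewrite -horner_evalE /det_pencil -!det_map_mx; congr (\det _).
    apply/matrixP => i j; rewrite !mxE /= /horner_eval rmorphB rmorphM /=.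
    rewrite map_polyX !map_polyC !hornerE /= mulrDr mulrA -expr2 sqr_i mulN1r.
    by [].
  rewrite detZ; apply: mulf_neq0; last by move: uY; rewrite unitmxE unitfE.
  by apply: expf_neq0; rewrite eq_complex /= oner_eq0 andbF.
by apply: contraNneq => ->; rewrite rmorph0 horner0.
Qed.

Lemma det_pencilE (R : realType) n (Y : 'M[R]_(n + n, n)) (tau : R) :
  (det_pencil Y).[tau] = \det (chart_den tau Y).
Proof.
rewrite -horner_evalE /det_pencil -det_map_mx; congr (\det _).
by apply/matrixP => i j; rewrite !mxE /= /horner_eval !hornerE.
Qed.

Lemma exists_chart (R : realType) n (Y Yh : 'M[R]_(n + n, n)) :
  lagrangian_plane Y -> lagrangian_plane Yh ->
  exists tau : R, chart_den tau Y \in unitmx /\ chart_den tau Yh \in unitmx.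
Proof.
move=> /det_pencil_neq0 pY /det_pencil_neq0 pYh.
have natI : injective (fun k : nat => k%:R : R) := mulrIn (oner_neq0 _).
have [k] := exists_nonroot (mulf_neq0 pY pYh) natI.
rewrite rootM negb_or /root !det_pencilE => /andP[dY dYh].
by exists k%:R; rewrite !unitmxE !unitfE.
Qed.

(** The matrix whose Cayley transform represents [Y] in [Gamma]. Its affine normalisation [chart],
    which vanishes at [vert_plane], is the one that enters the comparative index. *)
Definition graph_of (R : realType) n (tau : R) (Y : 'M[R]_(n + n, n)) : 'M[R[i]]_n :=
  cmx ((1 + tau ^+ 2) *: chart tau Y - tau%:M).

Lemma graph_of_ctr (R : realType) n (tau : R) (Y : 'M[R]_(n + n, n)) :
  wronskian Y Y = 0 -> chart_den tau Y \in unitmx ->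
  (graph_of tau Y)^t* = graph_of tau Y.
Proof.
move=> isoY uY; rewrite /graph_of ctrmx_real linearB linearZ /= tr_scalar_mx.
by rewrite chart_sym.
Qed.

(* [X - iU = (tau - i)^-1 (I - iB) Z] and [X + iU = (tau + i)^-1 (I + iB) Z],
   where [B] is the graph of [Y] in the chart and [Z] its denominator. *)
Lemma chart_cayley (K : comUnitRingType) n (i tau : K) (N Z X U : 'M[K]_n) :
  i ^+ 2 = -1 -> X = N *m Z -> U = tau *: X - Z ->
  (1%:M - i *: ((1 + tau ^+ 2) *: N - tau%:M)) *m Z = (tau - i) *: (X - i *: U) /\
  (1%:M + i *: ((1 + tau ^+ 2) *: N - tau%:M)) *m Z = (tau + i) *: (X + i *: U).
Proof.
move=> i2 eX ->; split.
  rewrite mulmxBl mul1mx -scalemxAl mulmxBl -scalemxAl mul_scalar_mx -eX.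
  apply/matrixP => k l; rewrite !mxE; ring: i2.
rewrite mulmxDl mul1mx -scalemxAl mulmxBl -scalemxAl mul_scalar_mx -eX.
apply/matrixP => k l; rewrite !mxE; ring: i2.
Qed.

Lemma mulmx_inv_scale (K : fieldType) n (a b : K) (P P' J J' Z : 'M[K]_n) :
  a != 0 -> b != 0 -> J \in unitmx -> Z \in unitmx ->
  J *m Z = a *: P -> J' *m Z = b *: P' ->
  P' *m invmx P = (a / b) *: (J' *m invmx J).
Proof.
move=> a0 b0 uJ uZ eP eP'.
have uP : P \in unitmx.
  have : a *: P \in unitmx by rewrite -eP unitmx_mul uJ.
  by rewrite unitmxZ // unitfE.
have -> : P' = b^-1 *: (J' *m Z) by rewrite eP' scalerA mulVf // scale1r.
have JP : invmx J *m P = a^-1 *: Z.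
  by apply: (can_inj (scalerK a0)); rewrite scalerA mulfV // scale1r scalemxAr -eP mulKmx.
apply: (can_inj (mulmxK uP)); rewrite mulmxKV // -scalemxAl -mulmxA JP -scalemxAr scalerA.
by congr (_ *: _); rewrite mulrAC divff // mul1r.
Qed.

(** The rotation multiplies the two quotients by [a / b] and [b / a], which cancel; this makes
    [Gamma] independent of the chart. *)
Lemma mulmx_quotient_scale (K : fieldType) n (a b : K)
    (P P' Q Q' J J' L L' Z W : 'M[K]_n) :
  a != 0 -> b != 0 -> J \in unitmx -> L' \in unitmx -> Z \in unitmx -> W \in unitmx ->
  J *m Z = a *: P -> J' *m Z = b *: P' -> L *m W = a *: Q -> L' *m W = b *: Q' ->
  P' *m invmx P *m Q *m invmx Q' = J' *m invmx J *m L *m invmx L'.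
Proof.
move=> a0 b0 uJ uL' uZ uW eP eP' eQ eQ'.
rewrite (mulmx_inv_scale a0 b0 uJ uZ eP eP') -mulmxA.
rewrite (mulmx_inv_scale b0 a0 uL' uW eQ' eQ).
rewrite -scalemxAl -scalemxAr scalerA mulrA divfK // divff // scale1r.
by rewrite !mulmxA.
Qed.

Lemma Gamma_chart (R : realType) n (tau : R) (Y Yh : 'M[R]_(n + n, n)) :
  wronskian Y Y = 0 -> wronskian Yh Yh = 0 ->
  chart_den tau Y \in unitmx -> chart_den tau Yh \in unitmx ->
  Gamma Y Yh =
  - cayley_quotient (cayley_den (graph_of tau Y)) (cayley_den (graph_of tau Yh)).
Proof.
move=> isoY isoYh uY uYh; rewrite /Gamma /cayley_quotient; congr (- _).
have hB := graph_of_ctr isoY uY; have hBh := graph_of_ctr isoYh uYh.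
have uJ := cayley_den_unit hB; have uJh := cayley_den_unit hBh.
pose t : R[i] := (tau%:C)%C.
have t1 : t - 'i%C != 0.
  by rewrite eq_complex /= negb_and add0r oppr_eq0 oner_eq0 orbT.
have t2 : t + 'i%C != 0.
  by rewrite eq_complex /= negb_and add0r oner_eq0 orbT.
have chartE (W : 'M[R]_(n + n, n)) : wronskian W W = 0 -> chart_den tau W \in unitmx ->
    cayley_den (graph_of tau W) *m cmx (chart_den tau W) = (t - 'i%C) *: cminus W /\
    (cayley_den (graph_of tau W))^t* *m cmx (chart_den tau W) = (t + 'i%C) *: cplus W.
  move=> isoW uW; rewrite cayley_den_ctr ?graph_of_ctr //.
  have gE : graph_of tau W = (1 + t ^+ 2) *: cmx (chart tau W) - t%:M.
    rewrite /graph_of map_mxB map_mxZ map_scalar_mx rmorphD rmorph1 rmorphXn.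
    by [].
  rewrite /cayley_den gE.
  apply: (chart_cayley (sqr_i R)).
    by rewrite -map_mxM -usubmx_chart.
  by rewrite (dsubmx_chart tau) map_mxB map_mxZ.
have [Y1 Y2] := chartE _ isoY uY; have [Yh1 Yh2] := chartE _ isoYh uYh.
have uZ : cmx (chart_den tau Y) \in unitmx by rewrite map_unitmx.
have uZh : cmx (chart_den tau Yh) \in unitmx by rewrite map_unitmx.
apply: (mulmx_quotient_scale t1 t2 uJ _ uZ uZh Y1 Y2 Yh1 Yh2).
by rewrite ctrmx_unit.
Qed.

(** * Continuity in a chart and local behaviour of the arc count *)

Lemma mx_cvg_ctr (C : numClosedFieldType) T (F : set_system T) (FF : Filter F) m n
    (f : T -> 'M[C]_(m, n)) A :
  mx_cvg F f A -> mx_cvg F (fun s => (f s)^t* ) (A^t* ).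
Proof.
move=> fA i j; rewrite !mxE; under eq_fun do rewrite !mxE.
apply/cvgrPdist_lt => e e0; have /cvgrPdist_lt/(_ _ e0) := fA j i.
by apply: filterS => s; rewrite -rmorphB norm_conjC.
Qed.

Lemma mx_cvg_usub (K : numFieldType) T (F : set_system T) m1 m2 n
    (f : T -> 'M[K]_(m1 + m2, n)) A :
  mx_cvg F f A -> mx_cvg F (fun s => usubmx (f s)) (usubmx A).
Proof. by move=> fA i j; rewrite mxE; under eq_fun do rewrite mxE; exact: fA. Qed.

Lemma mx_cvg_dsub (K : numFieldType) T (F : set_system T) m1 m2 n
    (f : T -> 'M[K]_(m1 + m2, n)) A :
  mx_cvg F f A -> mx_cvg F (fun s => dsubmx (f s)) (dsubmx A).
Proof. by move=> fA i j; rewrite mxE; under eq_fun do rewrite mxE; exact: fA. Qed.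

Lemma mx_cvg_cayley_den (C : numClosedFieldType) T (F : set_system T)
    (FF : Filter F) n (f : T -> 'M[C]_n) A :
  mx_cvg F f A -> mx_cvg F (fun s => cayley_den (f s)) (cayley_den A).
Proof.
move=> fA; apply: mx_cvgD; first exact: mx_cvg_cst.
by apply: mx_cvgN; exact: mx_cvgZ.
Qed.

Lemma mx_cvg_arc_perturb (C : numClosedFieldType) T (F : set_system T)
    (FF : Filter F) n (q s : C) (f : T -> 'M[C]_n) A :
  mx_cvg F f A -> A \in unitmx ->
  mx_cvg F (fun x => arc_perturb q s (f x)) (arc_perturb q s A).
Proof.
move=> fA uA; apply: mx_cvgZ; apply: mx_cvgD; apply: mx_cvgZ.
  exact: mx_cvg_inv.
by apply: mx_cvg_inv; [exact: mx_cvg_ctr | rewrite ctrmx_unit].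
Qed.

Lemma mx_cvg_cayley_graph (C : numClosedFieldType) T (F : set_system T)
    (FF : Filter F) n (q s : C) (f g : T -> 'M[C]_n) A B :
  mx_cvg F f A -> mx_cvg F g B -> cayley_den A \in unitmx ->
  mx_cvg F (fun x => block_mx (f x - g x) 1%:M 1%:M (- arc_perturb q s (cayley_den (f x))))
    (block_mx (A - B) 1%:M 1%:M (- arc_perturb q s (cayley_den A))).
Proof.
move=> fA gB uA; apply: mx_cvg_block.
- by apply: mx_cvgD => //; exact: mx_cvgN.
- exact: mx_cvg_cst.
- exact: mx_cvg_cst.
- by apply: mx_cvgN; apply: mx_cvg_arc_perturb => //; exact: mx_cvg_cayley_den.
Qed.

Lemma neg_inertia_graph_diff (R : realType) n (tau : R) (Y Yh : 'M[R]_(n + n, n)) :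
  (chart tau Y)^T = chart tau Y -> (chart tau Yh)^T = chart tau Yh ->
  neg_inertia (graph_of tau Y - graph_of tau Yh) =
  neg_inertia (cmx (chart tau Y - chart tau Yh)).
Proof.
move=> hY hYh.
have -> : graph_of tau Y - graph_of tau Yh =
    (((1 + tau ^+ 2)%:C)%C) *: cmx (chart tau Y - chart tau Yh).
  by rewrite -map_mxB -map_mxZ; congr (map_mx _ _); rewrite scalerBr opprB addrA subrK.
apply: neg_inertiaZ; last by rewrite ctrmx_real linearB /= hY hYh.
by rewrite (ltcR 0) ltr_wpDr // sqr_ge0.
Qed.

Section ChartContinuity.
Variables (R : realType) (n : nat) (T : Type) (F : set_system T).
Hypothesis (FF : Filter F).
Variables (Y : T -> 'M[R]_(n + n, n)) (Y0 : 'M[R]_(n + n, n)).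
Hypothesis (cY : mx_cvg F Y Y0).

Lemma cplus_cvg : mx_cvg F (fun s => cplus (Y s)) (cplus Y0).
Proof.
apply: mx_cvgD; first by apply: mx_cvg_real; exact: mx_cvg_usub.
by apply: mx_cvgZ; apply: mx_cvg_real; exact: mx_cvg_dsub.
Qed.

Lemma cminus_cvg : mx_cvg F (fun s => cminus (Y s)) (cminus Y0).
Proof.
apply: mx_cvgD; first by apply: mx_cvg_real; exact: mx_cvg_usub.
by apply: mx_cvgN; apply: mx_cvgZ; apply: mx_cvg_real; exact: mx_cvg_dsub.
Qed.

Lemma chart_den_cvg tau : mx_cvg F (fun s => chart_den tau (Y s)) (chart_den tau Y0).
Proof.
apply: mx_cvgD; first by apply: mx_cvgZ; exact: mx_cvg_usub.
by apply: mx_cvgN; exact: mx_cvg_dsub.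
Qed.

Lemma graph_of_cvg tau : chart_den tau Y0 \in unitmx ->
  mx_cvg F (fun s => graph_of tau (Y s)) (graph_of tau Y0).
Proof.
move=> u0; apply: mx_cvg_real; apply: mx_cvgD; last exact: mx_cvg_cst.
apply: mx_cvgZ; apply: mx_cvgM; first exact: mx_cvg_usub.
by apply: mx_cvg_inv => //; exact: chart_den_cvg.
Qed.

End ChartContinuity.

Lemma Gamma_cvg (R : realType) n T (F : set_system T) (FF : Filter F)
    (Y Yh : T -> 'M[R]_(n + n, n)) Y0 Yh0 :
  mx_cvg F Y Y0 -> mx_cvg F Yh Yh0 -> lagrangian_plane Y0 -> lagrangian_plane Yh0 ->
  mx_cvg F (fun s => Gamma (Y s) (Yh s)) (Gamma Y0 Yh0).
Proof.
move=> cY cYh lY lYh; apply: mx_cvgN.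
apply: mx_cvgM; last by apply: mx_cvg_inv; [exact: cplus_cvg | exact: cplus_unit].
apply: mx_cvgM; last exact: cminus_cvg.
apply: mx_cvgM; first exact: cplus_cvg.
by apply: mx_cvg_inv; [exact: cminus_cvg | exact: cminus_unit].
Qed.

Lemma Gamma_unit_near (R : realType) n T (F : set_system T) (FF : Filter F)
    (Y Yh : T -> 'M[R]_(n + n, n)) Y0 Yh0 (w : R[i]) :
  mx_cvg F Y Y0 -> mx_cvg F Yh Yh0 -> lagrangian_plane Y0 -> lagrangian_plane Yh0 ->
  Gamma Y0 Yh0 - w%:M \in unitmx ->
  \forall s \near F, Gamma (Y s) (Yh s) - w%:M \in unitmx.
Proof.
move=> cY cYh lY lYh; apply: near_unitmx; apply: mx_cvgD; last exact: mx_cvg_cst.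
exact: Gamma_cvg.
Qed.

Lemma arc_count_chart (R : realType) n (tau e : R) (Y Yh : 'M[R]_(n + n, n))
    (Q := graph_mx e (graph_of tau Y) (graph_of tau Yh)) :
  0 < e < pi -> wronskian Y Y = 0 -> wronskian Yh Yh = 0 ->
  chart_den tau Y \in unitmx -> chart_den tau Yh \in unitmx ->
  Gamma Y Yh - (expi (pi + e))%:M \in unitmx ->
  [/\ (arc_count (Gamma Y Yh) e + neg_inertia (cmx (chart tau Y - chart tau Yh)) =
       neg_inertia Q)%N, Q^t* = Q & Q \in unitmx].
Proof.
move=> epi isoY isoYh uY uYh; rewrite (Gamma_chart isoY isoYh uY uYh).
rewrite expiD_pi raddfN /= -opprD => uG.
have uG' : cayley_quotient (cayley_den (graph_of tau Y)) (cayley_den (graph_of tau Yh))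
    - (expi e)%:M \in unitmx.
  by move: uG; rewrite -scaleN1r unitmxZ // unitrN unitr1.
have hB := graph_of_ctr isoY uY; have hBh := graph_of_ctr isoYh uYh.
have [arcE hQ uQ] := arc_count_cayley epi hB hBh uG'; split => //.
by rewrite -arcE neg_inertia_graph_diff // chart_sym.
Qed.

Lemma graph_mx_cvg (R : realType) n T (F : set_system T) (FF : Filter F) (tau e : R)
    (Y Yh : T -> 'M[R]_(n + n, n)) Y0 Yh0 :
  mx_cvg F Y Y0 -> mx_cvg F Yh Yh0 -> wronskian Y0 Y0 = 0 ->
  chart_den tau Y0 \in unitmx -> chart_den tau Yh0 \in unitmx ->
  mx_cvg F (fun s => graph_mx e (graph_of tau (Y s)) (graph_of tau (Yh s)))
    (graph_mx e (graph_of tau Y0) (graph_of tau Yh0)).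
Proof.
move=> cY cYh isoY0 u0 uh0; have gY := graph_of_cvg FF cY u0.
have gYh := graph_of_cvg FF cYh uh0.
exact: (mx_cvg_cayley_graph FF gY gYh (cayley_den_unit (graph_of_ctr isoY0 u0))).
Qed.

Lemma arc_count_local (R : realType) n T (F : set_system T) (FF : Filter F) (tau e : R)
    (Y Yh : T -> 'M[R]_(n + n, n)) Y0 Yh0 :
  mx_cvg F Y Y0 -> mx_cvg F Yh Yh0 ->
  lagrangian_plane Y0 -> lagrangian_plane Yh0 ->
  (\forall s \near F, wronskian (Y s) (Y s) = 0) ->
  (\forall s \near F, wronskian (Yh s) (Yh s) = 0) ->
  chart_den tau Y0 \in unitmx -> chart_den tau Yh0 \in unitmx ->
  0 < e < pi -> Gamma Y0 Yh0 - (expi (pi + e))%:M \in unitmx ->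
  \forall s \near F,
    (arc_count (Gamma (Y s) (Yh s)) e +
       neg_inertia (cmx (chart tau (Y s) - chart tau (Yh s))) =
     arc_count (Gamma Y0 Yh0) e +
       neg_inertia (cmx (chart tau Y0 - chart tau Yh0)))%N.
Proof.
move=> cY cYh lY0 lYh0 isoY isoYh u0 uh0 epi uG0.
have uY := near_unitmx FF (chart_den_cvg FF cY (tau := tau)) u0.
have uYh := near_unitmx FF (chart_den_cvg FF cYh (tau := tau)) uh0.
have uG := Gamma_unit_near FF cY cYh lY0 lYh0 uG0.
have [arc0 hQ0 uQ0] := arc_count_chart epi lY0.1 lYh0.1 u0 uh0 uG0.
have cQ := graph_mx_cvg FF (e := e) cY cYh lY0.1 u0 uh0.
have hQ : \forall s \near F,
    (graph_mx e (graph_of tau (Y s)) (graph_of tau (Yh s)))^t* =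
     graph_mx e (graph_of tau (Y s)) (graph_of tau (Yh s)).
  near=> s.
  have iY : wronskian (Y s) (Y s) = 0 by near: s.
  have iYh : wronskian (Yh s) (Yh s) = 0 by near: s.
  have vY : chart_den tau (Y s) \in unitmx by near: s.
  have vYh : chart_den tau (Yh s) \in unitmx by near: s.
  have vG : Gamma (Y s) (Yh s) - (expi (pi + e))%:M \in unitmx by near: s.
  by have [] := arc_count_chart epi iY iYh vY vYh vG.
have indQ := near_neg_inertia FF cQ hQ0 hQ uQ0.
near=> s.
have iY : wronskian (Y s) (Y s) = 0 by near: s.
have iYh : wronskian (Yh s) (Yh s) = 0 by near: s.
have vY : chart_den tau (Y s) \in unitmx by near: s.
have vYh : chart_den tau (Yh s) \in unitmx by near: s.
have vG : Gamma (Y s) (Yh s) - (expi (pi + e))%:M \in unitmx by near: s.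
have [arcs _ _] := arc_count_chart epi iY iYh vY vYh vG.
apply: etrans arcs _; apply: etrans (esym arc0).
by near: s.
Unshelve. all: by end_near.
Qed.

(** * Maslov index of a path *)

Definition clamp (R : realType) (c d s : R) : R := Num.max c (Num.min s d).

Lemma clamp_bounds (R : realType) (c d s : R) : c <= d -> c <= clamp c d s <= d.
Proof. by move=> cd; rewrite /clamp le_max lexx ge_max cd ge_min lexx orbT. Qed.

Lemma clamp_id (R : realType) (c d s : R) : c <= s <= d -> clamp c d s = s.
Proof. by move=> /andP[cs sd]; rewrite /clamp min_l // max_r. Qed.

Lemma clamp_le (R : realType) (c d s : R) : s <= c -> c <= d -> clamp c d s = c.
Proof.
by move=> sc cd; rewrite /clamp min_l ?(le_trans sc) // max_l.
Qed.

Lemma clamp_ge (R : realType) (c d s : R) : d <= s -> c <= d -> clamp c d s = d.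
Proof. by move=> ds cd; rewrite /clamp min_r // max_r. Qed.

Lemma clamp_dist (R : realType) (c d s u : R) : c <= d ->
  `|clamp c d s - clamp c d u| <= `|s - u|.
Proof.
move=> cd; wlog su : s u / s <= u.
  move=> h; have [/h//|/ltW/h] := leP s u.
  by rewrite distrC [`|u - s|]distrC.
rewrite distrC [`|s - u|]distrC [leRHS]ger0_norm ?subr_ge0 // ler_norml.
rewrite /clamp !maxEle !minEle.
have [?|?] := leP s d; have [?|?] := leP u d; rewrite ?cd;
  have [?|?] := leP c s; have [?|?] := leP c u; apply/andP; split; lra.
Qed.

(** Clamping is 1-Lipschitz and takes values in [[c, d]], hence in [[a, b]]. *)
Lemma near_clamp (R : realType) (a b c d s0 : R) (P : R -> Prop) :
  a <= c -> c <= d -> d <= b ->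
  (\forall u \near within [set` `[a, b]] (nbhs (clamp c d s0)), P u) ->
  \forall s \near within [set` `[a, b]] (nbhs s0), P (clamp c d s).
Proof.
move=> ac cd db; rewrite !near_withinE => /nbhs_ballP[r /= r0 rP].
apply/nbhs_ballP; exists r => //= s; rewrite /ball /= => s0s _.
apply: rP.
  by rewrite /ball /=; apply: le_lt_trans s0s; exact: clamp_dist.
have /andP[h1 h2] := clamp_bounds s cd.
by rewrite /= in_itv /= (le_trans ac h1) (le_trans h2 db).
Qed.

(** The increments telescope. The minimum with [t p] carries the induction, in which [s] may lie
    beyond the partial partition. *)
Lemma sum_clamp (R : realType) (V : zmodType) (delta : R -> V) (t : nat -> R) p s :
  t 0%N <= s -> (forall k, (k < p)%N -> t k < t k.+1) ->
  \sum_(k < p) (delta (clamp (t k) (t k.+1) s) - delta (t k)) =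
  delta (Num.min s (t p)) - delta (t 0%N).
Proof.
move=> t0s; elim: p => [_|p IH tp]; first by rewrite big_ord0 min_r // subrr.
rewrite big_ord_recr /= IH => [|k kp]; last by rewrite tp // ltnW.
have tpp := tp p (ltnSn p).
have [stp|tps] := leP s (t p).
  rewrite clamp_le // ?(ltW tpp) // subrr addr0 min_l //.
  by rewrite (le_trans stp) // ltW.
rewrite addrC addrA subrK; congr (delta _ - _).
by rewrite /clamp max_r // le_min (ltW tps) ltW.
Qed.

(** [sum_clamp] distributes the increment of [delta] over the subintervals, so each [N k + delta] is
    compared separately although [N k] changes with [k]. *)
Lemma sum_clamp_local (R : realType) (V : zmodType) (N : nat -> R -> V)
    (delta : R -> V) (t : nat -> R) p s s0 :
  t 0%N <= s <= t p -> t 0%N <= s0 <= t p -> (forall k, (k < p)%N -> t k < t k.+1) ->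
  (forall k : 'I_p, N k (clamp (t k) (t k.+1) s) + delta (clamp (t k) (t k.+1) s) =
     N k (clamp (t k) (t k.+1) s0) + delta (clamp (t k) (t k.+1) s0)) ->
  \sum_(k < p) (N k (clamp (t k) (t k.+1) s) - N k (t k)) + delta s =
  \sum_(k < p) (N k (clamp (t k) (t k.+1) s0) - N k (t k)) + delta s0.
Proof.
move=> sab s0ab tlt sP.
have mE u : t 0%N <= u <= t p ->
    \sum_(k < p) (N k (clamp (t k) (t k.+1) u) - N k (t k)) + delta u =
    \sum_(k < p) (N k (clamp (t k) (t k.+1) u) + delta (clamp (t k) (t k.+1) u)
                   - (N k (t k) + delta (t k))) + delta (t 0%N).
  move=> /andP[au ub]; have := sum_clamp delta au tlt; rewrite min_l // => sE.
  rewrite -[delta u](subrK (delta (t 0%N))) -sE addrA -big_split /=.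
  by congr (_ + _); apply: eq_bigr => k _; rewrite opprD addrACA.
rewrite !mE //; congr (_ + _); apply: eq_bigr => k _.
by rewrite sP.
Qed.

(** The index of the path restricted to [[a, s]], computed with a fixed partition of [[a, b]]: a
    subinterval to the right of [s] is clamped to its left end and contributes 0. *)
Definition maslov_fun (R : realType) n (G : R -> 'M[R[i]]_n) (p : nat)
    (t eps : nat -> R) (s : R) : int :=
  \sum_(k < p) ((arc_count (G (clamp (t k) (t k.+1) s)) (eps k.+1))%:Z -
                (arc_count (G (t k)) (eps k.+1))%:Z).

Section MaslovPartition.
Variables (R : realType) (n : nat) (a b : R) (G : R -> 'M[R[i]]_n).
Variables (p : nat) (t eps : nat -> R).
Hypothesis part : maslov_partition a b G p t eps.

Lemma partition_le i j : (i <= j)%N -> (j <= p)%N -> t i <= t j.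
Proof.
have [_ _ tlt] := part.
elim: j => [|j IH]; first by rewrite leqn0 => /eqP ->.
rewrite leq_eqVlt => /orP[/eqP -> //|ij jp].
have [tj _ _] := tlt j jp.
by apply: le_trans (ltW tj); apply: IH => //; rewrite ltnW.
Qed.

Lemma partition_bounds k : (k < p)%N -> [/\ a <= t k, t k <= t k.+1 & t k.+1 <= b].
Proof.
have [<- <- tlt] := part; move=> kp; have [tk _ _] := tlt k kp.
by rewrite (partition_le (leq0n k) (ltnW kp)) (ltW tk) (partition_le kp (leqnn p)).
Qed.

Lemma maslov_fun_left : maslov_fun G p t eps a = 0.
Proof.
rewrite /maslov_fun big1 // => k _; have [ak kk _] := partition_bounds (ltn_ord k).
by rewrite clamp_le // subrr.
Qed.

Lemma maslov_fun_right : maslov_fun G p t eps b = maslov_sum G p t eps.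
Proof.
apply: eq_bigr => k _; have [_ kk kb] := partition_bounds (ltn_ord k).
by rewrite clamp_ge.
Qed.

(** A subinterval not containing [s0] has a constant clamp near [s0]. At a partition point two
    subintervals with possibly different [eps] are involved, which is why the hypothesis ranges over
    all admissible [e]. *)
Lemma maslov_fun_local (delta : R -> int) (s0 : R) : s0 \in `[a, b] ->
  (forall e, 0 < e < pi -> G s0 - (expi (pi + e))%:M \in unitmx ->
     \forall s \near within [set` `[a, b]] (nbhs s0),
       (arc_count (G s) e)%:Z + delta s = (arc_count (G s0) e)%:Z + delta s0) ->
  \forall s \near within [set` `[a, b]] (nbhs s0),
    maslov_fun G p t eps s + delta s = maslov_fun G p t eps s0 + delta s0.
Proof.
move=> s0ab loc; have [ta tb tlt] := part.
pose c k s := clamp (t k) (t k.+1) s.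
have termP (k : 'I_p) : \forall s \near within [set` `[a, b]] (nbhs s0),
    (arc_count (G (c k s)) (eps k.+1))%:Z + delta (c k s) =
    (arc_count (G (c k s0)) (eps k.+1))%:Z + delta (c k s0).
  have [ak kk kb] := partition_bounds (ltn_ord k).
  have [_ epi uG] := tlt k (ltn_ord k).
  have [s0k|ks0] := ltP s0 (t k).
    rewrite near_withinE; apply: filterS (lt_nbhsl s0k) => s sk _.
    by rewrite /c !clamp_le // ltW.
  have [ks0'|s0k] := ltP (t k.+1) s0.
    rewrite near_withinE; apply: filterS (lt_nbhsr ks0') => s sk _.
    by rewrite /c !clamp_ge // ltW.
  have cs0 : c k s0 = s0 by rewrite /c clamp_id // ks0.
  apply: (near_clamp (P := fun u => (arc_count (G u) (eps k.+1))%:Z + delta u =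
    (arc_count (G (c k s0)) (eps k.+1))%:Z + delta (c k s0))) => //.
  rewrite -/(c k s0) cs0; apply: loc => //.
  by have [] := uG s0; rewrite ?in_itv /= ?ks0.
have allP : \forall s \near within [set` `[a, b]] (nbhs s0), forall k : 'I_p,
    (arc_count (G (c k s)) (eps k.+1))%:Z + delta (c k s) =
    (arc_count (G (c k s0)) (eps k.+1))%:Z + delta (c k s0).
  exact: filter_forall.
have inab : \forall s \near within [set` `[a, b]] (nbhs s0), s \in `[a, b].
  exact: withinT.
near=> s.
have sab : s \in `[a, b] by near: s.
have sP : forall k : 'I_p,
    (arc_count (G (c k s)) (eps k.+1))%:Z + delta (c k s) =
    (arc_count (G (c k s0)) (eps k.+1))%:Z + delta (c k s0) by near: s.
apply: (sum_clamp_local (N := fun k s => (arc_count (G s) (eps k.+1))%:Z)) => //.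
- by rewrite ta tb; move: sab; rewrite in_itv.
- by rewrite ta tb; move: s0ab; rewrite in_itv.
- by move=> k kp; have [] := tlt k kp.
Unshelve. all: by end_near.
Qed.

End MaslovPartition.

(** * Existence of partitions *)

Lemma partition_exists (R : realType) n (a b : R) (G : R -> 'M[R[i]]_n) : a <= b ->
  (forall s0, s0 \in `[a, b] -> exists2 e, 0 < e < pi &
     \forall s \near within [set` `[a, b]] (nbhs s0),
       G s - (expi (pi + e))%:M \in unitmx /\ G s - (expi (pi - e))%:M \in unitmx) ->
  exists p t eps, maslov_partition a b G p t eps.
Proof.
move=> ab loc.
(* The partition may reach beyond [x]. Then a point [x'] up to [y] needs no change, and for [x']
   beyond [y] one interval [[y, x']] is appended; as [x <= y], it stays inside the ball where [e]
   works. *)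
pose P x := exists y, [/\ x <= y, a <= y <= b & exists p t eps, maslov_partition a y G p t eps].
have : P b.
  apply: (@locally_constant R a b P) => //; last first.
    exists a; rewrite !lexx ab; split => //.
    by exists 0%N, (fun=> a), (fun=> a); split.
  move=> s0 s0ab; have [e epi] := loc s0 s0ab; rewrite !near_withinE => /nbhs_ballP[r /= r0 rP].
  apply/nbhs_ballP; exists r => //= s s0s sab.
  have step x x' : ball s0 r x -> ball s0 r x' ->
      x \in `[a, b] -> x' \in `[a, b] -> P x -> P x'.
    move=> bx bx' xab x'ab [y [xy /andP[ay yb] [p [t [eps [ta ty tlt]]]]]].
    have [x'y|yx'] := leP x' y.
      by exists y; rewrite x'y ay yb; split => //; exists p, t, eps.
    move: x'ab; rewrite in_itv /= => /andP[ax' x'b].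
    exists x'; rewrite lexx ax' x'b; split => //.
    exists p.+1, (fun k => if (k <= p)%N then t k else x'),
      (fun k => if (k <= p)%N then eps k else e).
    split => /=; rewrite ?ltnn // => k; rewrite ltnS => kp.
    have [->|nkp] := eqVneq k p; last first.
      have kp' : (k < p)%N by rewrite ltn_neqAle nkp.
      by rewrite kp kp'; exact: tlt.
    rewrite leqnn ltnn ty; split => // u; rewrite in_itv /= => /andP[yu ux'].
    have uab : u \in `[a, b].
      by rewrite in_itv /= (le_trans ay yu) (le_trans ux' x'b).
    apply: rP => //; move: bx bx'; rewrite /ball /= !ltr_norml.
    by move=> /andP[? ?] /andP[? ?]; apply/andP; split; lra.
  by split; apply: step => //; exact: ballxx.
move=> [y [xy /andP[ay yb] [p [t [eps h]]]]]; exists p, t, eps.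
by have <- : y = b by apply: le_anti; rewrite yb xy.
Qed.

Lemma unitmx_sub_scalar (F : fieldType) n (A : 'M[F]_n) (w : F) :
  (A - w%:M \in unitmx) = ~~ root (char_poly A) w.
Proof.
rewrite -eigenvalue_root_char -row_free_unit -kermx_eq0.
by rewrite /eigenvalue /eigenspace negbK.
Qed.

(** The points at [pi + e] and [pi - e] are conjugate, so both conditions say that the first is not
    a root of the characteristic polynomial times its conjugate. The values [e = 1 / (k + 1)] give
    infinitely many distinct candidates, all below [pi]. *)
Lemma exists_arc_gap (R : realType) n (A : 'M[R[i]]_n) :
  exists2 e : R, 0 < e < pi &
    A - (expi (pi + e))%:M \in unitmx /\ A - (expi (pi - e))%:M \in unitmx.
Proof.
pose p := char_poly A; pose p' := map_poly Num.conj p.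
have p0 : p != 0 by rewrite monic_neq0 // char_poly_monic.
have pp0 : p * p' != 0 by rewrite mulf_neq0 // map_poly_eq0.
pose e k : R := k.+1%:R^-1.
have e0 k : 0 < e k by rewrite invr_gt0.
have e1 k : e k <= 1 by rewrite invf_le1 ?ler1n.
have pi2 := pi_ge2 R.
have wI : injective (fun k => expi (pi + e k)).
  move=> j k /= /expi_inj; rewrite -/(e j) => h.
  have /addrI/invr_inj/eqP : pi + e j = pi + e k.
    apply: h; have := e0 j; have := e0 k; have := e1 j; have := e1 k => *;
      apply/andP; split; lra.
  by rewrite eqr_nat eqSS => /eqP.
have [k] := exists_nonroot pp0 wI.
rewrite rootM negb_or => /andP[k1 k2]; exists (e k).
  by rewrite e0 (le_lt_trans (e1 k)) //; lra.
rewrite !unitmx_sub_scalar; split => //.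
have -> : expi (pi - e k) = (expi (pi + e k))^*.
  rewrite conj_expi /expi opprD cosD sinD cosN sinN cosB sinB cospi sinpi.
  rewrite cosN sinN cospi sinpi.
  by congr Complex; ring.
apply: contra k2; rewrite /root /p' => /eqP h.
by rewrite -[expi _]conjCK horner_map h rmorph0.
Qed.

Lemma path_cvg (R : realType) n (a b : R) (Y : R -> 'M[R]_(n + n, n)) (s0 : R) :
  lagrangian_path a b Y -> s0 \in `[a, b] ->
  mx_cvg (within [set` `[a, b]] (nbhs s0)) Y (Y s0).
Proof.
move=> [/subspace_continuousP cY _] s0ab i j.
apply: (@continuous_cvg _ _ _ _ _ _ (fun M : 'M[R]_(n + n, n) => M i j)).
  exact: coord_continuous.
exact: cY.
Qed.

Lemma path_isotropic (R : realType) n (a b : R) (Y : R -> 'M[R]_(n + n, n)) (s0 : R) :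
  lagrangian_path a b Y ->
  \forall s \near within [set` `[a, b]] (nbhs s0), wronskian (Y s) (Y s) = 0.
Proof.
move=> [_ lY].
have inab : \forall s \near within [set` `[a, b]] (nbhs s0), s \in `[a, b].
  exact: withinT.
by apply: filterS inab => s sab; have [] := lY s sab.
Qed.

Lemma vert_lagrangian (R : realType) n : lagrangian_plane (vert_plane : 'M[R]_(n + n, n)).
Proof.
split; first exact: vert_isotropic.
by rewrite -addsmxE adds0mx mxrank1.
Qed.

Lemma vert_path (R : realType) n (a b : R) :
  lagrangian_path a b (fun=> vert_plane : 'M[R]_(n + n, n)).
Proof.
split=> [|t _]; last exact: vert_lagrangian.
by apply/subspace_continuousP => x _; exact: cvg_cst.
Qed.

(** Every point has a gap [e] that persists nearby by continuity of [Gamma], so partitions exist and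
    [xget] returns the sum of one of them instead of its default 0. *)
Lemma maslov_exists (R : realType) n (a b : R) (Y Yh : R -> 'M[R]_(n + n, n)) :
  a <= b -> lagrangian_path a b Y -> lagrangian_path a b Yh ->
  exists p t eps, maslov_partition a b (fun s => Gamma (Y s) (Yh s)) p t eps /\
    maslov Y Yh a b = maslov_sum (fun s => Gamma (Y s) (Yh s)) p t eps.
Proof.
move=> ab hY hYh; pose G s := Gamma (Y s) (Yh s); rewrite -/G.
have [p [t [eps part]]] : exists p t eps, maslov_partition a b G p t eps.
  apply: partition_exists => // s0 s0ab.
  have [e epi [u1 u2]] := exists_arc_gap (G s0).
  have lY := hY.2 s0 s0ab; have lYh := hYh.2 s0 s0ab.
  have cY := path_cvg hY s0ab; have cYh := path_cvg hYh s0ab.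
  have FF : Filter (within [set` `[a, b]] (nbhs s0)) by exact: within_filter.
  have n1 := Gamma_unit_near FF cY cYh lY lYh u1.
  have n2 := Gamma_unit_near FF cY cYh lY lYh u2.
  by exists e => //; exact: filterI n1 n2.
have [p' [t' [eps' [part' eqm]]]] : [set m : int | exists p t eps,
    maslov_partition a b G p t eps /\ m = maslov_sum G p t eps] (maslov Y Yh a b).
  by apply: xgetPex; exists (maslov_sum G p t eps), p, t, eps.
by exists p', t', eps'.
Qed.

Lemma maslov_local (R : realType) n (a b : R) (Y Yh : R -> 'M[R]_(n + n, n))
    (G := fun s => Gamma (Y s) (Yh s)) p t eps tau s0
    (delta := fun s => (neg_inertia (cmx (chart tau (Y s) - chart tau (Yh s))))%:Z) :
  lagrangian_path a b Y -> lagrangian_path a b Yh ->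
  maslov_partition a b G p t eps -> s0 \in `[a, b] ->
  chart_den tau (Y s0) \in unitmx -> chart_den tau (Yh s0) \in unitmx ->
  \forall s \near within [set` `[a, b]] (nbhs s0),
    maslov_fun G p t eps s + delta s = maslov_fun G p t eps s0 + delta s0.
Proof.
move=> hY hYh part s0ab uY uYh; apply: (maslov_fun_local part) => // e epi uG.
have FF : Filter (within [set` `[a, b]] (nbhs s0)) by exact: within_filter.
have := arc_count_local FF (path_cvg hY s0ab) (path_cvg hYh s0ab) (hY.2 s0 s0ab)
  (hYh.2 s0 s0ab) (path_isotropic s0 hY) (path_isotropic s0 hYh) uY uYh epi uG.
have PoszE (x y z w : nat) : (x + y = z + w)%N -> x%:Z + y%:Z = z%:Z + w%:Z.
  by rewrite -!PoszD => ->.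
by apply: filterS => s; exact: PoszE.
Qed.

Lemma comp_index_refl (R : realType) n (Y : 'M[R]_(n + n, n)) :
  wronskian Y Y = 0 -> comp_index Y Y = 0%N.
Proof.
move=> W0; rewrite /comp_index.
have -> : comp_index_M Y Y = 0 by rewrite /comp_index_M W0 mulmx0.
have -> : comp_index_P Y Y = 0 by rewrite /comp_index_P W0 trmx0 mulmx0 !mul0mx.
by rewrite mxrank0 neg_index_inertia ?trmx0 // map_mx0 neg_inertia0.
Qed.

Theorem corollary5p4 (R : realType) (n : nat) (a b : R) (hab : a <= b)
  (Y Yh : R -> 'M[R]_(n + n, n))
  (hY : lagrangian_path a b Y) (hYh : lagrangian_path a b Yh) :
  maslov Y Yh a b =
    maslov (fun=> vert_plane) Yh a b - maslov (fun=> vert_plane) Y a b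
    + (comp_index (Yh a) (Y a))%:Z - (comp_index (Yh b) (Y b))%:Z
  /\ (Y a = Yh a -> Y b = Yh b ->
      maslov Y Yh a b =
        maslov (fun=> vert_plane) Yh a b - maslov (fun=> vert_plane) Y a b).
Proof.
have aab : a \in `[a, b] by rewrite in_itv /= lexx.
have bab : b \in `[a, b] by rewrite in_itv /= lexx hab.
suff masE : maslov Y Yh a b =
    maslov (fun=> vert_plane) Yh a b - maslov (fun=> vert_plane) Y a b
    + (comp_index (Yh a) (Y a))%:Z - (comp_index (Yh b) (Y b))%:Z.
  split=> // eqa eqb; rewrite masE eqa eqb.
  by rewrite !comp_index_refl ?addr0 ?subr0 //; apply: (proj1 (hYh.2 _ _)).
have hE := vert_path n a b.
have [p1 [t1 [e1 [part1 ->]]]] := maslov_exists hab hY hYh.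
have [p2 [t2 [e2 [part2 ->]]]] := maslov_exists hab hE hYh.
have [p3 [t3 [e3 [part3 ->]]]] := maslov_exists hab hE hY.
pose f s := maslov_fun (fun s => Gamma (Y s) (Yh s)) p1 t1 e1 s
  - maslov_fun (fun s => Gamma vert_plane (Yh s)) p2 t2 e2 s
  + maslov_fun (fun s => Gamma vert_plane (Y s)) p3 t3 e3 s
  + (comp_index (Yh s) (Y s))%:Z.
have : f b = f a.
  apply: (@locally_constant R a b (fun s => f s = f a)) => // s0 s0ab.
  have lY := hY.2 s0 s0ab; have lYh := hYh.2 s0 s0ab.
  have [tau [uY uYh]] := exists_chart lY lYh.
  have FF : Filter (within [set` `[a, b]] (nbhs s0)) by exact: within_filter.
  have uE := chart_den_vert_unit n tau.
  have n1 := maslov_local hY hYh part1 s0ab uY uYh.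
  have n2 := maslov_local hE hYh part2 s0ab uE uYh.
  have n3 := maslov_local hE hY part3 s0ab uE uY.
  have nY := near_unitmx FF (chart_den_cvg FF (path_cvg hY s0ab) (tau := tau)) uY.
  have nYh := near_unitmx FF (chart_den_cvg FF (path_cvg hYh s0ab) (tau := tau)) uYh.
  have iY := path_isotropic s0 hY; have iYh := path_isotropic s0 hYh.
  (* Since [vert_plane] has chart 0, each [- N] is written as a difference from its chart, the form
     in which it occurs in [n2] and [n3]. *)
  have nC : \forall s \near within [set` `[a, b]] (nbhs s0),
      (comp_index (Yh s) (Y s) +
         neg_inertia (cmx (chart tau vert_plane - chart tau (Yh s))) =
       neg_inertia (cmx (chart tau (Y s) - chart tau (Yh s))) +
         neg_inertia (cmx (chart tau vert_plane - chart tau (Y s))))%N.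
    rewrite chart_vert; near=> s; rewrite !sub0r.
    by apply: comp_index_chart; near: s.
  have C0 : (comp_index (Yh s0) (Y s0) +
         neg_inertia (cmx (chart tau vert_plane - chart tau (Yh s0))) =
       neg_inertia (cmx (chart tau (Y s0) - chart tau (Yh s0))) +
         neg_inertia (cmx (chart tau vert_plane - chart tau (Y s0))))%N.
    by rewrite chart_vert !sub0r; exact: comp_index_chart lY.1 lYh.1 uY uYh.
  (* [d1], [d2], [d3] are the chart-dependent inertias accompanying the three Maslov sums. They
     enter as [- d1 + d2 - d3], which the comparative index [c] compensates. *)
  have cancel (u1 u1' u2 u2' u3 u3' : int) (c c' d1 d1' d2 d2' d3 d3' : nat) :
      u1 + d1%:Z = u1' + d1'%:Z -> u2 + d2%:Z = u2' + d2'%:Z ->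
      u3 + d3%:Z = u3' + d3'%:Z -> (c + d2 = d1 + d3)%N -> (c' + d2' = d1' + d3')%N ->
      u1 - u2 + u3 + c%:Z = u1' - u2' + u3' + c'%:Z by lia.
  suff : \forall s \near within [set` `[a, b]] (nbhs s0), f s = f s0.
    by apply: filterS => s ->.
  apply: filterS (filterI (filterI n1 n2) (filterI n3 nC)) => s [[h1 h2] [h3 h4]].
  exact: cancel h1 h2 h3 h4 C0.
have total (x1 x2 x3 y1 y2 y3 z1 z2 z3 c d : int) :
    x1 = 0 -> x2 = 0 -> x3 = 0 -> y1 = z1 -> y2 = z2 -> y3 = z3 ->
    y1 - y2 + y3 + d = x1 - x2 + x3 + c -> z1 = z2 - z3 + c - d by lia.
apply: total; [exact: maslov_fun_left part1 | exact: maslov_fun_left part2 |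
  exact: maslov_fun_left part3 | exact: maslov_fun_right part1 |
  exact: maslov_fun_right part2 | exact: maslov_fun_right part3].
Unshelve. all: by end_near.
Qed.
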